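(* Let $V=V_{\mathrm{ev}}$ (respectively $V=V_{\mathrm{od}}$), and let $\mathrm{Imm}_*=\mathrm{Imm}_{\mathrm{ev}}$ (respectively $\mathrm{Imm}_*=\mathrm{Imm}_{\mathrm{od}}$). The map $$\Phi:(e,f)\longmapsto c,\qquad c(\theta)=\tfrac12\int_0^\theta\big(e(x)+if(x)\big)^2\,dx,$$ restricts to a map $$\Phi:\mathbf{St}^0(2,V)\longrightarrow\{c\in\mathrm{Imm}_*(S^1,\mathbb C): c(0)=0,\ \ell(c)=1\},$$ and this map is an isometric 2-fold covering, where $\mathbf{St}^0(2,V)$ carries the metric $\|(\delta e,\delta f)\|^2=\|\delta e\|^2+\|\delta f\|^2$ and the space of curves carries the (restriction of the) metric $G$.
   Context: $S^1$ is identified with $\mathbb R/2\pi\mathbb Z$. $V_{\mathrm{ev}}$ is the space of $C^\infty$ functions $f:\mathbb R\to\mathbb R$ with $f(\theta+2\pi)=f(\theta)$; $V_{\mathrm{od}}$ is the space of $C^\infty$ functions $f:\mathbb R\to\mathbb R$ with $f(\theta+2\pi)=-f(\theta)$. Both carry the (weak) inner product $\langle f,g\rangle=\int_0^{2\pi}f(x)g(x)\,dx$ and norm $\|f\|^2=\langle f,f\rangle$. $\mathbf{St}(2,V)$ is the Stiefel manifold of orthonormal pairs $(e,f)\in V\times V$; $\mathbf{St}^0(2,V)$ is the subset of pairs such that $e$ and $f$ have no common zero. The tangent space of $\mathbf{St}(2,V)$ at $(e,f)$ is the set of pairs $(\delta e,\delta f)\in V^2$ with $\langle e,\delta e\rangle=\langle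 f,\delta f\rangle=\langle e,\delta f\rangle+\langle f,\delta e\rangle=0$. $\mathrm{Imm}_{\mathrm{ev}}(S^1,\mathbb C)$ and $\mathrm{Imm}_{\mathrm{od}}(S^1,\mathbb C)$ are the spaces of $C^\infty$ immersions $c:S^1\to\mathbb C$ of even, respectively odd, rotation degree (the winding number of $c'$ around $0$). $\ell(c)$ is the length of $c$, $ds=|c_\theta|\,d\theta$ and $D_s=|c_\theta|^{-1}\partial_\theta$. For $h:S^1\to\mathbb C$ a vector field along $c$ (modulo constant fields), $$G_c(h,h)=\frac1{\ell(c)}\int_{S^1}|D_sh|^2\,ds .$$
   Formalization: With the stated constants the map is isometric only up to a factor: the formal theorem proves that G of the image vector equals 2(‖δe‖²+‖δf‖²), not ‖δe‖²+‖δf‖²; literal equality fails for every non-zero tangent vector. *)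

(* Defs.v *)
(* Stdlib reals with Coquelicot. *)
From Stdlib Require Import Reals ZArith Lia Lra.
From Stdlib Require Import FunctionalExtensionality ProofIrrelevance.
From Coquelicot Require Import Coquelicot.

Set Implicit Arguments.
Unset Strict Implicit.

Local Open Scope R_scope.

(** * The Frechet space C^oo(R, R) *)

Definition smooth (f : R -> R) : Prop := forall (n : nat) (x : R), ex_derive_n f n x.

Record smooth_fun : Type := SmoothFun {
  smooth_map :> R -> R;
  smooth_mapP : smooth smooth_map
}.

Lemma smooth_fun_eq (f g : smooth_fun) : (forall x, f x = g x) -> f = g.
Proof.
destruct f as [f Hf], g as [g Hg]; simpl; intros E.
assert (f = g) as <- by (apply functional_extensionality; exact E).
now rewrite (proof_irrelevance _ Hf Hg).
Qed.

Lemma smooth_all_locally (f : R -> R) (n : nat) (x : R) : smooth f ->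
  locally x (fun y => forall k, (k <= n)%nat -> ex_derive_n f k y).
Proof. intros Hf; apply filter_forall; intros y k _; apply Hf. Qed.

Lemma smooth_const (a : R) : smooth (fun _ => a).
Proof. intros n x; apply ex_derive_n_const. Qed.

Lemma smooth_plus (f g : R -> R) : smooth f -> smooth g -> smooth (fun x => f x + g x).
Proof. intros Hf Hg n x; apply ex_derive_n_plus; now apply smooth_all_locally. Qed.

Lemma smooth_opp (f : R -> R) : smooth f -> smooth (fun x => - f x).
Proof. intros Hf n x; now apply ex_derive_n_opp. Qed.

Lemma smooth_scal (a : R) (f : R -> R) : smooth f -> smooth (fun x => a * f x).
Proof. intros Hf n x; now apply ex_derive_n_scal_l. Qed.

Lemma smooth_ext (f g : R -> R) : (forall x, f x = g x) -> smooth f -> smooth g.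
Proof. intros E Hf n x; now apply ex_derive_n_ext with f. Qed.

Lemma Derive_n_shift (f : R -> R) (n : nat) (x : R) :
  Derive_n (Derive f) n x = Derive_n f (S n) x.
Proof.
replace (S n) with (n + 1)%nat by lia; exact (Derive_n_comp f n 1 x).
Qed.

Lemma ex_derive_n_shift (f : R -> R) (n : nat) (x : R) :
  ex_derive_n (Derive f) (S n) x -> ex_derive_n f (S (S n)) x.
Proof. apply ex_derive_ext; intros t; apply Derive_n_shift. Qed.

Lemma smooth_ex_derive (f : R -> R) (x : R) : smooth f -> ex_derive f x.
Proof. intros Hf; exact (Hf 1%nat x). Qed.

Lemma smooth_Derive (f : R -> R) : smooth f -> smooth (Derive f).
Proof.
intros Hf [|n] x; [exact I|].
apply ex_derive_ext with (Derive_n f (S n)); [|exact (Hf (S (S n)) x)].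
intros t; symmetry; apply Derive_n_shift.
Qed.

Lemma smooth_mult (f g : R -> R) : smooth f -> smooth g -> smooth (fun x => f x * g x).
Proof.
intros Hf Hg n.
cut (forall k, (k <= n)%nat -> forall f g, smooth f -> smooth g ->
  forall x, ex_derive_n (fun x => f x * g x) k x).
{ intros H; apply (H n (le_n n)); assumption. }
clear f g Hf Hg; induction n as [|n IH]; intros k Hk f g Hf Hg x.
{ replace k with 0%nat by lia; exact I. }
destruct k as [|[|k]]; [exact I | |].
{ apply @ex_derive_mult; now apply smooth_ex_derive. }
refine (ex_derive_n_shift (f := fun x => f x * g x) _).
apply ex_derive_n_ext with (fun t => Derive f t * g t + f t * Derive g t).
{ intros t; symmetry; apply Derive_mult; now apply smooth_ex_derive. }
apply ex_derive_n_plus; apply filter_forall; intros y j Hj; apply IH;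
  (lia || assumption || now apply smooth_Derive).
Qed.

Lemma smooth_continuous (f : R -> R) (x : R) : smooth f -> continuous f x.
Proof. intros Hf; apply (ex_derive_continuous f x), smooth_ex_derive, Hf. Qed.

Lemma smooth_is_RInt (f : R -> R) (a b : R) : smooth f -> is_RInt f a b (RInt f a b).
Proof.
intros Hf; apply (@RInt_correct R_CompleteNormedModule).
apply (@ex_RInt_continuous R_CompleteNormedModule).
intros z _; now apply smooth_continuous.
Qed.

Lemma smooth_RInt (f : R -> R) (a : R) : smooth f -> smooth (fun x => RInt f a x).
Proof.
intros Hf.
assert (D : forall x, is_derive (fun x => RInt f a x) x (f x)).
{ intros x; apply is_derive_RInt with a; [|now apply smooth_continuous].
  apply filter_forall; intros y; now apply smooth_is_RInt. }
intros [|[|n]] x; [exact I | exists (f x); apply D |].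
refine (ex_derive_n_shift (f := fun x => RInt f a x) _).
apply ex_derive_n_ext with f; [|apply Hf].
intros t; symmetry; apply is_derive_unique, D.
Qed.

Definition smooth_fun_zero : smooth_fun := SmoothFun (smooth_const 0).
Definition smooth_fun_plus (f g : smooth_fun) : smooth_fun :=
  SmoothFun (smooth_plus (smooth_mapP f) (smooth_mapP g)).
Definition smooth_fun_opp (f : smooth_fun) : smooth_fun :=
  SmoothFun (smooth_opp (smooth_mapP f)).
Definition smooth_fun_scal (a : R) (f : smooth_fun) : smooth_fun :=
  SmoothFun (smooth_scal a (smooth_mapP f)).

Definition smooth_fun_AbelianMonoid_mixin : AbelianMonoid.mixin_of smooth_fun.
Proof.
exists smooth_fun_plus smooth_fun_zero.
- intros f g; apply smooth_fun_eq; intros x; apply Rplus_comm.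
- intros f g h; apply smooth_fun_eq; intros x; simpl; ring.
- intros f; apply smooth_fun_eq; intros x; apply Rplus_0_r.
Defined.

Canonical smooth_fun_AbelianMonoid :=
  AbelianMonoid.Pack smooth_fun smooth_fun_AbelianMonoid_mixin smooth_fun.

Definition smooth_fun_AbelianGroup_mixin : AbelianGroup.mixin_of smooth_fun_AbelianMonoid.
Proof.
exists smooth_fun_opp.
intros f; apply smooth_fun_eq; intros x; apply Rplus_opp_r.
Defined.

Definition smooth_fun_AbelianGroup_class : AbelianGroup.class_of smooth_fun :=
  AbelianGroup.Class smooth_fun smooth_fun_AbelianMonoid_mixin
    smooth_fun_AbelianGroup_mixin.

Canonical smooth_fun_AbelianGroup :=
  AbelianGroup.Pack smooth_fun smooth_fun_AbelianGroup_class smooth_fun.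

Definition smooth_fun_ModuleSpace_mixin :
  ModuleSpace.mixin_of R_Ring smooth_fun_AbelianGroup.
Proof.
exists smooth_fun_scal.
- intros a b f; apply smooth_fun_eq; intros x; unfold mult; simpl; ring.
- intros f; apply smooth_fun_eq; intros x; apply Rmult_1_l.
- intros a f g; apply smooth_fun_eq; intros x; unfold plus; simpl; ring.
- intros a b f; apply smooth_fun_eq; intros x; unfold plus; simpl; ring.
Defined.

Definition smooth_fun_ModuleSpace_class : ModuleSpace.class_of R_Ring smooth_fun :=
  ModuleSpace.Class R_Ring smooth_fun smooth_fun_AbelianGroup_class
    smooth_fun_ModuleSpace_mixin.

Canonical smooth_fun_ModuleSpace :=
  ModuleSpace.Pack R_Ring smooth_fun smooth_fun_ModuleSpace_class smooth_fun.

(* The C^oo topology: uniform convergence on compact sets of every derivative.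
   The ball of radius [eps] constrains the derivatives of order < 1/eps on the
   interval (-1/eps, 1/eps), so that a single uniformity carries all the
   seminorms. On 2PI-(anti)periodic functions this is uniform convergence of
   every derivative. *)
Definition smooth_fun_ball (f : smooth_fun) (eps : R) (g : smooth_fun) : Prop :=
  forall (k : nat) (x : R), INR k * eps < 1 -> Rabs x * eps < 1 ->
    Rabs (Derive_n g k x - Derive_n f k x) < eps.

Lemma smooth_fun_ball_pos (f : smooth_fun) (eps : R) (g : smooth_fun) :
  smooth_fun_ball f eps g -> 0 < eps.
Proof.
intros H; specialize (H 0%nat 0); rewrite Rabs_R0, !Rmult_0_l in H.
eapply Rle_lt_trans; [apply Rabs_pos | exact (H Rlt_0_1 Rlt_0_1)].
Qed.

Definition smooth_fun_UniformSpace_mixin : UniformSpace.mixin_of smooth_fun.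
Proof.
refine (UniformSpace.Mixin _ smooth_fun_zero smooth_fun_ball _ _ _).
- intros f eps k x _ _; rewrite Rminus_eq_0, Rabs_R0; apply cond_pos.
- intros f g eps H k x Hk Hx; rewrite Rabs_minus_sym; now apply H.
- intros f g h e1 e2 H1 H2 k x Hk Hx.
  assert (P1 := smooth_fun_ball_pos H1); assert (P2 := smooth_fun_ball_pos H2).
  assert (Nk := pos_INR k); assert (Nx := Rabs_pos x).
  assert (Q1 : Rabs (Derive_n g k x - Derive_n f k x) < e1) by (apply H1; nra).
  assert (Q2 : Rabs (Derive_n h k x - Derive_n g k x) < e2) by (apply H2; nra).
  replace (Derive_n h k x - Derive_n f k x) with
    ((Derive_n g k x - Derive_n f k x) + (Derive_n h k x - Derive_n g k x)) by ring.
  eapply Rle_lt_trans; [apply Rabs_triang | lra].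
Defined.

Canonical smooth_fun_UniformSpace :=
  UniformSpace.Pack smooth_fun smooth_fun_UniformSpace_mixin smooth_fun.

(* [NormedModuleAux] is a vector space with a uniform structure: no norm is involved. *)
Canonical smooth_fun_NormedModuleAux :=
  NormedModuleAux.Pack R_AbsRing smooth_fun
    (NormedModuleAux.Class R_AbsRing smooth_fun
       smooth_fun_ModuleSpace_class smooth_fun_UniformSpace_mixin)
    smooth_fun.

(** * Differential calculus and coverings in topological vector spaces *)

Section Paths.

Context {E : NormedModuleAux R_AbsRing}.

Definition is_velocity (gamma : R -> E) (t : R) (v : E) : Prop :=
  filterlim (fun h : R => scal (/ h) (minus (gamma (t + h)) (gamma t)))
    (locally' 0) (locally v).

Definition smooth_path (gamma : R -> E) : Prop :=
  exists D : nat -> R -> E, (forall t, D 0%nat t = gamma t) /\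
    forall k t, is_velocity (D k) t (D (S k) t).

Definition relatively_open (A W : E -> Prop) : Prop :=
  exists O : E -> Prop, open O /\ forall x, W x <-> A x /\ O x.

End Paths.

(* Smoothness in the sense of convenient calculus: smooth paths go to smooth paths. *)
Definition smooth_on {E F : NormedModuleAux R_AbsRing} (A : E -> Prop) (p : E -> F) : Prop :=
  forall gamma : R -> E, smooth_path gamma -> (forall t, A (gamma t)) ->
    smooth_path (fun t => p (gamma t)).

Definition is_directional_derivative {E F : NormedModuleAux R_AbsRing}
    (p : E -> F) (x v : E) (w : F) : Prop :=
  is_velocity (fun t : R => p (plus x (scal t v))) 0 w.

(* [p] restricts to an [n]-fold covering [A -> B] in the smooth category:
   [sheet i] for [i < n] are the sheets over the evenly covered neighbourhood
   [U], and [sec i] is the inverse of the diffeomorphism [p : sheet i -> U]. *)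
Definition smooth_covering {E F : NormedModuleAux R_AbsRing} (n : nat)
    (A : E -> Prop) (B : F -> Prop) (p : E -> F) : Prop :=
  (forall x, A x -> B (p x)) /\ continuous_on A p /\ smooth_on A p /\
  forall b, B b -> exists U : F -> Prop, relatively_open B U /\ U b /\
    exists (sheet : nat -> E -> Prop) (sec : nat -> F -> E),
      (forall x, A x /\ U (p x) <-> exists i, (i < n)%nat /\ sheet i x) /\
      (forall i j x, (i < n)%nat -> (j < n)%nat -> sheet i x -> sheet j x -> i = j) /\
      forall i, (i < n)%nat ->
        relatively_open A (sheet i) /\
        (forall x, sheet i x -> sec i (p x) = x) /\
        (forall y, U y -> sheet i (sec i y) /\ p (sec i y) = y) /\
        continuous_on U (sec i) /\ smooth_on U (sec i).

(** * The spaces V_ev and V_od and their Stiefel manifolds *)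

Inductive parity : Set := ev | od.

Definition V (s : parity) (f : smooth_fun) : Prop :=
  forall x, f (x + 2 * PI) = match s with ev => f x | od => - f x end.

Definition inner (f g : smooth_fun) : R := RInt (fun x => f x * g x) 0 (2 * PI).

Definition norm_sq (f : smooth_fun) : R := inner f f.

Notation smooth_pair := (smooth_fun * smooth_fun)%type.

Definition St (s : parity) (p : smooth_pair) : Prop :=
  V s (fst p) /\ V s (snd p) /\
  inner (fst p) (fst p) = 1 /\ inner (snd p) (snd p) = 1 /\ inner (fst p) (snd p) = 0.

Definition St0 (s : parity) (p : smooth_pair) : Prop :=
  St s p /\ forall x, ~ (fst p x = 0 /\ snd p x = 0).

Definition tangent_St (s : parity) (p v : smooth_pair) : Prop :=
  V s (fst v) /\ V s (snd v) /\
  inner (fst p) (fst v) = 0 /\ inner (snd p) (snd v) = 0 /\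
  inner (fst p) (snd v) + inner (snd p) (fst v) = 0.

Definition metric_St (v : smooth_pair) : R := norm_sq (fst v) + norm_sq (snd v).

(** * Plane curves *)

(* A smooth map R -> C is represented by the pair of its real and imaginary parts. *)
Definition to_C (c : smooth_pair) (x : R) : C := (fst c x, snd c x).

Definition C_deriv (c : smooth_pair) (x : R) : C := (Derive (fst c) x, Derive (snd c) x).

Definition periodic (c : smooth_pair) : Prop :=
  forall x, to_C c (x + 2 * PI) = to_C c x.

Definition winding_number (g : R -> C) (d : Z) : Prop :=
  exists alpha : R -> R, (forall x, continuous alpha x) /\
    (forall x, g x = Cmult (Cmod (g x)) (cos (alpha x), sin (alpha x))) /\
    alpha (2 * PI) - alpha 0 = 2 * PI * IZR d.

Definition rotation_degree (c : smooth_pair) (d : Z) : Prop :=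
  winding_number (C_deriv c) d.

Definition Imm (s : parity) (c : smooth_pair) : Prop :=
  periodic c /\ (forall x, C_deriv c x <> 0%C) /\
  exists d, rotation_degree c d /\ match s with ev => Z.Even d | od => Z.Odd d end.

Definition curve_length (c : smooth_pair) : R :=
  RInt (fun x => Cmod (C_deriv c x)) 0 (2 * PI).

Definition based_unit_curves (s : parity) (c : smooth_pair) : Prop :=
  Imm s c /\ to_C c 0 = 0%C /\ curve_length c = 1.

(* The tangent space at [c] of the level set {c(0) = 0, length = 1} in the open
   set of immersions: [h(0) = 0], and the length has zero derivative along [h]. *)
Definition tangent_based_unit_curves (c h : smooth_pair) : Prop :=
  periodic h /\ to_C h 0 = 0%C /\
  is_derive (fun t : R => curve_length (plus c (scal t h))) 0 0.

Definition Ds (c h : smooth_pair) (x : R) : C :=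
  Cmult (/ Cmod (C_deriv c x))%R (C_deriv h x).

(* With c' = (e + if)^2 / 2 and h' = (e + if)(de + i df) one gets
   |D_s h|^2 ds = |h'|^2 / |c'| dx = 2 |de + i df|^2 dx, so that with this
   normalisation of c and of the metric, the differential of [Phi] multiplies
   squared norms by exactly 2. *)
Definition metric_G (c h : smooth_pair) : R :=
  / curve_length c *
  RInt (fun x => Cmod (Ds c h x) ^ 2 * Cmod (C_deriv c x)) 0 (2 * PI).

(** * The map Phi *)

Definition Phi_curve (p : smooth_pair) (theta : R) : C :=
  Cmult (/ 2)%R
    (RInt (V := C_R_CompleteNormedModule)
       (fun x => Cpow (Cplus (fst p x) (Cmult Ci (snd p x))) 2) 0 theta).

Lemma Phi_curveE (p : smooth_pair) (theta : R) :
  Phi_curve p theta =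
  (/ 2 * RInt (fun x => fst p x * fst p x + - (snd p x * snd p x)) 0 theta,
   / 2 * RInt (fun x => 2 * (fst p x * snd p x)) 0 theta).
Proof.
assert (S1 : smooth (fun x => fst p x * fst p x + - (snd p x * snd p x))).
{ apply smooth_plus; [|apply smooth_opp]; apply smooth_mult; apply smooth_mapP. }
assert (S2 : smooth (fun x => 2 * (fst p x * snd p x))).
{ apply smooth_scal, smooth_mult; apply smooth_mapP. }
unfold Phi_curve.
rewrite (@is_RInt_unique C_R_CompleteNormedModule _ 0 theta
  (RInt (fun x => fst p x * fst p x + - (snd p x * snd p x)) 0 theta,
   RInt (fun x => 2 * (fst p x * snd p x)) 0 theta)).
{ unfold Cmult; simpl; f_equal; ring. }
apply (@is_RInt_fct_extend_pair R_NormedModule R_NormedModule).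
- refine (is_RInt_ext _ _ _ _ _ _ (smooth_is_RInt S1)).
  intros x _; simpl; ring.
- refine (is_RInt_ext _ _ _ _ _ _ (smooth_is_RInt S2)).
  intros x _; simpl; ring.
Qed.

Lemma smooth_Re_Phi (p : smooth_pair) : smooth (fun x => Re (Phi_curve p x)).
Proof.
apply smooth_ext with
  (fun t => / 2 * RInt (fun x => fst p x * fst p x + - (snd p x * snd p x)) 0 t).
{ intros x; now rewrite Phi_curveE. }
apply smooth_scal, smooth_RInt, smooth_plus; [|apply smooth_opp];
  apply smooth_mult; apply smooth_mapP.
Qed.

Lemma smooth_Im_Phi (p : smooth_pair) : smooth (fun x => Im (Phi_curve p x)).
Proof.
apply smooth_ext with (fun t => / 2 * RInt (fun x => 2 * (fst p x * snd p x)) 0 t).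
{ intros x; now rewrite Phi_curveE. }
apply smooth_scal, smooth_RInt, smooth_scal, smooth_mult; apply smooth_mapP.
Qed.

Definition Phi (p : smooth_pair) : smooth_pair :=
  (SmoothFun (smooth_Re_Phi p), SmoothFun (smooth_Im_Phi p)).

(* Main.v *)
Require Import Defs.
From Stdlib Require Import Reals Lra Lia ZArith ClassicalEpsilon.
From Coquelicot Require Import Coquelicot.
Local Open Scope R_scope.

(** Write z = e + if, so that [Phi (e, f)] is the curve c with c(0) = 0 and c' = z^2 / 2.
    Then |c'| = |z|^2 / 2, the conditions <e, f> = 0 and ||e|| = ||f|| say that c closes up, and the
    angle of c' is twice that of z, which turns the (anti)periodicity of z into the parity of the
    rotation degree. Conversely, half the angle of c' gives a smooth square root of 2 c'.

    Near a curve c with lift z0, every curve y with Re (y' conj c') > 0 has exactly the two lifts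
    +- 2 sqrt (y' conj c') / conj z0 (principal square root), told apart by the sign of
    Re (z conj z0). They are continuous and smooth in y because sums, products, derivatives,
    primitives, and inverses and square roots of positive functions are: convergence of all
    derivatives is preserved by these operations, and so is the class of smooth paths, since the
    velocity of an expression built with them is again such an expression.

    The differential of [Phi] at z maps w to the primitive of zw; its inverse is h |-> h' / z. *)

(** * Smooth functions *)

(** No inverse function theorem is available in the Frechet space of smooth functions, so the local
    inverses of [Phi] are given by formulas. Comparison with a known lift makes this possible: (z
    conj z0)^2 = 4 y' conj c', and where y' conj c' stays in the open right half-plane its principal
    root involves only real inverses and real square roots of everywhere positive functions. No
    angle has to be chosen for y; one is chosen only for the centre c, to obtain z0, and the parity
    of the lift of y can be read off the formula. Smoothness is needed in three senses: of functions
    of x, of limits in which all derivatives converge, and of paths of functions. Explicit higher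
    derivatives of quotients and roots would be unwieldy, so only first derivatives are ever
    computed. The higher orders follow because the derivative stays in the class under
    consideration, or by an induction on the order that is quantified over all functions. *)

Lemma smooth_of_class (P : (R -> R) -> Prop) :
  (forall f, P f -> exists g, P g /\ forall x, is_derive f x (g x)) ->
  forall f, P f -> smooth f.
Proof.
intros H f Hf n; revert f Hf; induction n as [|n IH]; intros f Hf x; [exact I|].
destruct (H f Hf) as (g & Hg & D).
destruct n as [|n]; [exists (g x); apply D|].
apply (ex_derive_n_shift (f := f)).
apply ex_derive_n_ext with g; [|now apply IH].
intros t; symmetry; apply is_derive_unique, D.
Qed.

(** The derivative of each constructor can again be written with these constructors: roots require
    inverses, and cosine and sine require each other. Positivity is demanded on all of R, so the
    square root is never taken at 0, where it is not differentiable. *)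
Inductive smooth_expr : (R -> R) -> Prop :=
| se_smooth f : smooth f -> smooth_expr f
| se_plus f g : smooth_expr f -> smooth_expr g -> smooth_expr (fun x => f x + g x)
| se_mult f g : smooth_expr f -> smooth_expr g -> smooth_expr (fun x => f x * g x)
| se_inv f : smooth_expr f -> (forall x, 0 < f x) -> smooth_expr (fun x => / f x)
| se_sqrt f : smooth_expr f -> (forall x, 0 < f x) -> smooth_expr (fun x => sqrt (f x))
| se_cos f : smooth_expr f -> smooth_expr (fun x => cos (f x))
| se_sin f : smooth_expr f -> smooth_expr (fun x => sin (f x)).

Lemma smooth_expr_smooth (f : R -> R) : smooth_expr f -> smooth f.
Proof.
revert f; apply smooth_of_class; intros f Hf.
assert (Hc : forall a, smooth_expr (fun _ => a)) by (intros a; apply se_smooth, smooth_const).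
induction Hf as [f Hf | f g Hf (f' & Ff & Df) Hg (g' & Gg & Dg)
  | f g Hf (f' & Ff & Df) Hg (g' & Gg & Dg) | f Hf (f' & Ff & Df) P | f Hf (f' & Ff & Df) P
  | f Hf (f' & Ff & Df) | f Hf (f' & Ff & Df)].
- exists (Derive f); split; [now apply se_smooth, smooth_Derive|].
  intros x; now apply Derive_correct, smooth_ex_derive.
- exists (fun x => f' x + g' x); split; [now apply se_plus|].
  intros x; now apply @is_derive_plus.
- exists (fun x => f' x * g x + f x * g' x); split; [now apply se_plus; apply se_mult|].
  intros x; apply (is_derive_mult f g x (f' x) (g' x)); auto; intros; apply Rmult_comm.
- exists (fun x => (-1) * (f' x * (/ f x * / f x))); split.
  { apply se_mult; [apply Hc|]; apply se_mult; [exact Ff|]; now apply se_mult; apply se_inv. }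
  intros x; specialize (P x).
  evar_last; [apply is_derive_inv; [apply Df | lra]|]. field; lra.
- exists (fun x => f' x * (/ 2 * / sqrt (f x))); split.
  { apply se_mult; [exact Ff|]; apply se_mult; [apply Hc|]; apply se_inv; [now apply se_sqrt|].
    intros x; now apply sqrt_lt_R0. }
  intros x; evar_last; [apply is_derive_sqrt; [apply Df | apply P]|].
  simpl; field; apply Rgt_not_eq, sqrt_lt_R0, P.
- exists (fun x => f' x * ((-1) * sin (f x))); split.
  { apply se_mult; [exact Ff|]; apply se_mult; [apply Hc|now apply se_sin]. }
  intros x; evar_last; [apply (is_derive_comp cos f); [apply is_derive_cos | apply Df]|].
  unfold scal; simpl; unfold mult; simpl; ring.
- exists (fun x => f' x * cos (f x)); split.
  { apply se_mult; [exact Ff|now apply se_cos]. }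
  intros x; evar_last; [apply (is_derive_comp sin f); [apply is_derive_sin | apply Df]|].
  unfold scal; simpl; unfold mult; simpl; ring.
Qed.

Lemma smooth_inv (f : R -> R) : smooth f -> (forall x, 0 < f x) -> smooth (fun x => / f x).
Proof. intros Hf P; apply smooth_expr_smooth, se_inv; [now apply se_smooth | exact P]. Qed.

Lemma smooth_sqrt (f : R -> R) : smooth f -> (forall x, 0 < f x) -> smooth (fun x => sqrt (f x)).
Proof. intros Hf P; apply smooth_expr_smooth, se_sqrt; [now apply se_smooth | exact P]. Qed.

Lemma smooth_cos (f : R -> R) : smooth f -> smooth (fun x => cos (f x)).
Proof. intros Hf; now apply smooth_expr_smooth, se_cos, se_smooth. Qed.

Lemma smooth_sin (f : R -> R) : smooth f -> smooth (fun x => sin (f x)).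
Proof. intros Hf; now apply smooth_expr_smooth, se_sin, se_smooth. Qed.

Lemma smooth_minus (f g : R -> R) : smooth f -> smooth g -> smooth (fun x => f x - g x).
Proof. intros Hf Hg; apply smooth_plus; [exact Hf | now apply smooth_opp]. Qed.

Lemma is_derive_smooth_RInt (f : R -> R) (a x : R) :
  smooth f -> is_derive (fun x => RInt f a x) x (f x).
Proof.
intros Hf; apply is_derive_RInt with a; [|now apply smooth_continuous].
apply filter_forall; intros y; now apply smooth_is_RInt.
Qed.

Lemma Derive_smooth_RInt (f : R -> R) (a x : R) :
  smooth f -> Derive (fun x => RInt f a x) x = f x.
Proof. intros Hf; now apply is_derive_unique, is_derive_smooth_RInt. Qed.

Lemma smooth_ex_RInt (f : R -> R) (a b : R) : smooth f -> ex_RInt f a b.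
Proof. intros Hf; exists (RInt f a b); now apply smooth_is_RInt. Qed.

Lemma RInt_Derive_smooth (f : R -> R) (a b : R) : smooth f -> RInt (Derive f) a b = f b - f a.
Proof.
intros Hf; apply RInt_Derive; intros x _; [now apply smooth_ex_derive|].
now apply smooth_continuous, smooth_Derive.
Qed.

Lemma smooth_bounded (f : R -> R) (M : R) : smooth f ->
  exists B, 0 < B /\ forall x, Rabs x <= M -> Rabs (f x) <= B.
Proof.
intros Hf.
destruct (Rlt_le_dec M 0) as [HM|HM].
{ exists 1; split; [lra|]; intros x Hx; assert (h := Rabs_pos x); lra. }
destruct (continuity_ab_maj (fun x => Rabs (f x)) (-M) M) as (m & Hm & _); [lra| |].
{ intros c _; apply continuity_pt_filterlim.
  apply (continuous_comp f Rabs); [now apply smooth_continuous | apply continuous_Rabs]. }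
exists (Rabs (f m) + 1); split; [assert (h := Rabs_pos (f m)); lra|].
intros x Hx; apply Rabs_le_between in Hx; assert (h := Hm x Hx); simpl in h; lra.
Qed.

Lemma smooth_pos_below (f : R -> R) (M : R) : smooth f -> (forall x, 0 < f x) ->
  exists m, 0 < m /\ forall x, Rabs x <= M -> m <= f x.
Proof.
intros Hf P.
destruct (Rlt_le_dec M 0) as [HM|HM].
{ exists 1; split; [lra|]; intros x Hx; assert (h := Rabs_pos x); lra. }
destruct (continuity_ab_min f (-M) M) as (m & Hm & _); [lra| |].
{ intros c _; apply continuity_pt_filterlim; now apply smooth_continuous. }
exists (f m); split; [apply P|].
intros x Hx; apply Rabs_le_between in Hx; apply Hm, Hx.
Qed.

Lemma RInt_smooth_plus (f g : R -> R) (a b : R) : smooth f -> smooth g ->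
  RInt (fun x => f x + g x) a b = RInt f a b + RInt g a b.
Proof.
intros Hf Hg; apply (RInt_plus (V := R_CompleteNormedModule)); now apply smooth_ex_RInt.
Qed.

Lemma RInt_smooth_minus (f g : R -> R) (a b : R) : smooth f -> smooth g ->
  RInt (fun x => f x - g x) a b = RInt f a b - RInt g a b.
Proof.
intros Hf Hg; apply (RInt_minus (V := R_CompleteNormedModule)); now apply smooth_ex_RInt.
Qed.

Lemma RInt_smooth_scal (l : R) (f : R -> R) (a b : R) : smooth f ->
  RInt (fun x => l * f x) a b = l * RInt f a b.
Proof. intros Hf; apply (RInt_scal (V := R_CompleteNormedModule)); now apply smooth_ex_RInt. Qed.

Lemma RInt_ext_all (f g : R -> R) (a b : R) : (forall x, f x = g x) -> RInt f a b = RInt g a b.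
Proof. intros E; apply RInt_ext; intros x _; apply E. Qed.

(** * Convergence of all derivatives along a filter *)

Definition unif_cv {T : Type} (F : (T -> Prop) -> Prop) (u : T -> R -> R) (f : R -> R) : Prop :=
  forall M eps, 0 < eps -> F (fun t => forall x, Rabs x <= M -> Rabs (u t x - f x) < eps).

(** The members of the family are bare functions, so their smoothness is part of the notion, and
    only eventually along [F], because inverses and roots are controlled only there. The bound [n]
    is what later inductions run on: order n + 1 of a product, an inverse or a root reduces to order
    n of an expression in derivatives. *)
Definition cv_upto {T : Type} (F : (T -> Prop) -> Prop) (n : nat) (u : T -> R -> R) (f : R -> R) :=
  F (fun t => smooth (u t)) /\ smooth f /\
  forall k, (k <= n)%nat -> unif_cv F (fun t => Derive_n (u t) k) (Derive_n f k).

Definition cv_all {T : Type} (F : (T -> Prop) -> Prop) (u : T -> R -> R) (f : R -> R) :=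
  forall n, cv_upto F n u f.

Section Convergence.

Context {T : Type} (F : (T -> Prop) -> Prop) {FF : Filter F}.

Lemma unif_cv_ext (u v : T -> R -> R) (f g : R -> R) :
  F (fun t => forall x, u t x = v t x) -> (forall x, f x = g x) ->
  unif_cv F u f -> unif_cv F v g.
Proof.
intros E1 E2 H M eps He; generalize (filter_and _ _ E1 (H M eps He)); apply filter_imp.
intros t [A B] x Hx; rewrite <- A, <- E2; now apply B.
Qed.

Lemma unif_cv_const (f : R -> R) : unif_cv F (fun _ => f) f.
Proof. intros M eps He; apply filter_forall; intros t x _; now rewrite Rminus_eq_0, Rabs_R0. Qed.

Lemma unif_cv_plus (u v : T -> R -> R) (f g : R -> R) : unif_cv F u f -> unif_cv F v g ->
  unif_cv F (fun t x => u t x + v t x) (fun x => f x + g x).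
Proof.
intros Hu Hv M eps He.
assert (He2 : 0 < eps / 2) by lra.
generalize (filter_and _ _ (Hu M _ He2) (Hv M _ He2)); apply filter_imp.
intros t [A B] x Hx; specialize (A x Hx); specialize (B x Hx).
replace (u t x + v t x - (f x + g x)) with ((u t x - f x) + (v t x - g x)) by ring.
eapply Rle_lt_trans; [apply Rabs_triang | lra].
Qed.

Lemma unif_cv_mult (u v : T -> R -> R) (f g : R -> R) : smooth f -> smooth g ->
  unif_cv F u f -> unif_cv F v g -> unif_cv F (fun t x => u t x * v t x) (fun x => f x * g x).
Proof.
intros Sf Sg Hu Hv M eps He.
destruct (smooth_bounded f M Sf) as (Bf & Pf & Hf).
destruct (smooth_bounded g M Sg) as (Bg & Pg & Hg).
(* The error is (u - f)(v - g) + (u - f) g + f (v - g). With both differences below d <= 1, it is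
   less than d (1 + Bg + Bf). *)
set (d := Rmin 1 (eps / (Bf + Bg + 1))).
assert (Hd : 0 < d).
{ apply Rmin_pos; [lra|]; apply Rdiv_lt_0_compat; lra. }
assert (Hd1 : d <= 1) by apply Rmin_l.
assert (Hd2 : d * (Bf + Bg + 1) <= eps).
{ apply Rle_trans with (eps / (Bf + Bg + 1) * (Bf + Bg + 1)).
  - apply Rmult_le_compat_r; [lra | apply Rmin_r].
  - right; field; lra. }
generalize (filter_and _ _ (Hu M d Hd) (Hv M d Hd)); apply filter_imp.
intros t [A B] x Hx; specialize (A x Hx); specialize (B x Hx).
specialize (Hf x Hx); specialize (Hg x Hx).
replace (u t x * v t x - f x * g x) with
  ((u t x - f x) * (v t x - g x) + (u t x - f x) * g x + f x * (v t x - g x)) by ring.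
eapply Rle_lt_trans; [apply Rabs_triang|].
eapply Rle_lt_trans; [apply Rplus_le_compat_r, Rabs_triang|].
rewrite !Rabs_mult.
assert (P1 := Rabs_pos (u t x - f x)); assert (P2 := Rabs_pos (v t x - g x)).
assert (P3 := Rabs_pos (f x)); assert (P4 := Rabs_pos (g x)).
assert (Rabs (u t x - f x) * Rabs (v t x - g x) < d * 1) by nra.
assert (Rabs (u t x - f x) * Rabs (g x) <= d * Bg) by nra.
assert (Rabs (f x) * Rabs (v t x - g x) <= Bf * d) by nra.
lra.
Qed.

Lemma unif_cv_inv (u : T -> R -> R) (f : R -> R) : smooth f -> (forall x, 0 < f x) ->
  unif_cv F u f -> unif_cv F (fun t x => / u t x) (fun x => / f x).
Proof.
intros Sf Pf Hu M eps He.
destruct (smooth_pos_below f M Sf Pf) as (m & Pm & Hm).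
(* The first bound keeps u above m / 2. Then |1/u - 1/f| = |u - f| / (u f) with u f >= m^2 / 2,
   which explains the second. *)
set (d := Rmin (m / 2) (eps * (m * m / 2))).
assert (Hd : 0 < d) by (apply Rmin_pos; [lra | apply Rmult_lt_0_compat; nra]).
generalize (Hu M d Hd); apply filter_imp.
intros t A x Hx; specialize (A x Hx); specialize (Hm x Hx).
assert (D1 : d <= m / 2) by apply Rmin_l.
assert (D2 : d <= eps * (m * m / 2)) by apply Rmin_r.
assert (Hux : m / 2 < u t x) by (apply Rabs_lt_between in A; lra).
replace (/ u t x - / f x) with (- (u t x - f x) * / (u t x * f x)) by (field; lra).
rewrite Rabs_mult, Rabs_Ropp, (Rabs_pos_eq (/ _)).
2:{ left; apply Rinv_0_lt_compat; nra. }
apply Rmult_lt_reg_r with (u t x * f x); [nra|].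
rewrite Rmult_assoc, Rinv_l, Rmult_1_r by nra.
assert (m * m / 2 <= u t x * f x) by nra.
assert (eps * (m * m / 2) <= eps * (u t x * f x)) by (apply Rmult_le_compat_l; lra).
lra.
Qed.

Lemma unif_cv_sqrt (u : T -> R -> R) (f : R -> R) : smooth f -> (forall x, 0 < f x) ->
  unif_cv F u f -> unif_cv F (fun t x => sqrt (u t x)) (fun x => sqrt (f x)).
Proof.
intros Sf Pf Hu M eps He.
destruct (smooth_pos_below f M Sf Pf) as (m & Pm & Hm).
assert (Psm : 0 < sqrt m) by now apply sqrt_lt_R0.
(* The first bound keeps u positive. Then |sqrt u - sqrt f| = |u - f| / (sqrt u + sqrt f), whose
   denominator is at least sqrt m. *)
set (d := Rmin m (eps * sqrt m)).
assert (Hd : 0 < d) by (apply Rmin_pos; [lra | now apply Rmult_lt_0_compat]).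
generalize (Hu M d Hd); apply filter_imp.
intros t A x Hx; specialize (A x Hx); specialize (Hm x Hx).
assert (D1 : d <= m) by apply Rmin_l.
assert (D2 : d <= eps * sqrt m) by apply Rmin_r.
assert (Hux : 0 < u t x) by (apply Rabs_lt_between in A; lra).
assert (Psf : sqrt m <= sqrt (f x)) by now apply sqrt_le_1_alt.
assert (Psu := sqrt_pos (u t x)).
assert (E : (sqrt (u t x) - sqrt (f x)) * (sqrt (u t x) + sqrt (f x)) = u t x - f x).
{ rewrite <- (sqrt_sqrt (u t x)) at 3 by lra; rewrite <- (sqrt_sqrt (f x)) at 3 by (specialize (Pf x); lra).
  ring. }
apply Rmult_lt_reg_r with (sqrt (u t x) + sqrt (f x)); [lra|].
rewrite <- (Rabs_pos_eq (sqrt (u t x) + sqrt (f x))) at 1 by lra.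
rewrite <- Rabs_mult, E.
assert (eps * sqrt m <= eps * (sqrt (u t x) + sqrt (f x))) by (apply Rmult_le_compat_l; lra).
lra.
Qed.

Lemma unif_cv_RInt (u : T -> R -> R) (f : R -> R) : F (fun t => smooth (u t)) -> smooth f ->
  unif_cv F u f -> unif_cv F (fun t x => RInt (u t) 0 x) (fun x => RInt f 0 x).
Proof.
intros Su Sf Hu M eps He.
(* Integration from 0 to x costs a factor |x| <= |M|. The added 1 makes the final inequality strict
   and allows M = 0. *)
set (d := eps / (Rabs M + 1)).
assert (PM := Rabs_pos M).
assert (Hd : 0 < d) by (apply Rdiv_lt_0_compat; lra).
generalize (filter_and _ _ Su (Hu (Rabs M) d Hd)); apply filter_imp.
intros t [S A] x Hx.
assert (SD : smooth (fun y => u t y - f y)) by now apply smooth_minus.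
assert (Hx' : Rabs x <= Rabs M) by (assert (h := Rle_abs M); lra).
assert (E : RInt (u t) 0 x - RInt f 0 x = RInt (fun y => u t y - f y) 0 x).
{ symmetry; now apply RInt_smooth_minus. }
rewrite E.
assert (Bd : Rabs (RInt (fun y => u t y - f y) 0 x) <= Rabs x * d).
{ destruct (Rle_lt_dec 0 x) as [P|P].
  - rewrite (Rabs_pos_eq x) by exact P; replace (x * d) with ((x - 0) * d) by ring.
    apply (norm_RInt_le_const (V := R_NormedModule) (fun y => u t y - f y) 0 x); [exact P| |].
    + intros y Hy; left; apply A; rewrite Rabs_pos_eq in Hx' by lra; rewrite Rabs_pos_eq; lra.
    + now apply smooth_is_RInt.
  - rewrite (Rabs_left x) by exact P; rewrite <- (opp_RInt_swap (V := R_CompleteNormedModule))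
      by (now apply smooth_ex_RInt).
    unfold opp; simpl; rewrite Rabs_Ropp; replace (- x * d) with ((0 - x) * d) by ring.
    apply (norm_RInt_le_const (V := R_NormedModule) (fun y => u t y - f y) x 0); [lra| |].
    + intros y Hy; left; apply A; rewrite Rabs_left in Hx' by lra.
      apply Rabs_le_between; lra.
    + now apply smooth_is_RInt. }
assert (Rabs x * d < (Rabs M + 1) * d) by nra.
replace ((Rabs M + 1) * d) with eps in H by (unfold d; field; lra).
lra.
Qed.

Lemma cv_upto_ext (n : nat) (u v : T -> R -> R) (f g : R -> R) :
  F (fun t => forall x, u t x = v t x) -> (forall x, f x = g x) ->
  cv_upto F n u f -> cv_upto F n v g.
Proof.
intros E1 E2 (S1 & S2 & H); split; [|split].
- generalize (filter_and _ _ E1 S1); apply filter_imp; intros t [A B]; now apply smooth_ext with (u t).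
- now apply smooth_ext with f.
- intros k Hk; apply unif_cv_ext with (3 := H k Hk).
  + revert E1; apply filter_imp; intros t A x; now apply Derive_n_ext.
  + intros x; now apply Derive_n_ext.
Qed.

Lemma cv_upto_le (n m : nat) (u : T -> R -> R) (f : R -> R) : (n <= m)%nat ->
  cv_upto F m u f -> cv_upto F n u f.
Proof. intros L (S1 & S2 & H); split; [|split]; auto; intros k Hk; apply H; lia. Qed.

Lemma cv_upto_S (n : nat) (u : T -> R -> R) (f : R -> R) :
  F (fun t => smooth (u t)) -> smooth f -> unif_cv F u f ->
  cv_upto F n (fun t => Derive (u t)) (Derive f) -> cv_upto F (S n) u f.
Proof.
intros S1 S2 U (_ & _ & H); split; [|split]; auto.
intros [|k] Hk; [exact U|].
apply unif_cv_ext with (3 := H k ltac:(lia)).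
- apply filter_forall; intros t x; apply Derive_n_shift.
- intros x; apply Derive_n_shift.
Qed.

Lemma cv_upto_Derive (n : nat) (u : T -> R -> R) (f : R -> R) :
  cv_upto F (S n) u f -> cv_upto F n (fun t => Derive (u t)) (Derive f).
Proof.
intros (S1 & S2 & H); split; [|split].
- revert S1; apply filter_imp; intros t; apply smooth_Derive.
- now apply smooth_Derive.
- intros k Hk; apply unif_cv_ext with (3 := H (S k) ltac:(lia)).
  + apply filter_forall; intros t x; symmetry; apply Derive_n_shift.
  + intros x; symmetry; apply Derive_n_shift.
Qed.

Lemma cv_upto_0 (u : T -> R -> R) (f : R -> R) :
  F (fun t => smooth (u t)) -> smooth f -> unif_cv F u f -> cv_upto F 0 u f.
Proof. intros S1 S2 U; split; [|split]; auto; intros k Hk; now replace k with 0%nat by lia. Qed.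

Lemma cv_upto_unif (n : nat) (u : T -> R -> R) (f : R -> R) : cv_upto F n u f -> unif_cv F u f.
Proof. intros (_ & _ & H); apply (H 0%nat); lia. Qed.

Lemma cv_upto_plus (n : nat) (u v : T -> R -> R) (f g : R -> R) :
  cv_upto F n u f -> cv_upto F n v g -> cv_upto F n (fun t x => u t x + v t x) (fun x => f x + g x).
Proof.
intros (S1 & S2 & H) (S3 & S4 & K); split; [|split].
- generalize (filter_and _ _ S1 S3); apply filter_imp; intros t [A B]; now apply smooth_plus.
- now apply smooth_plus.
- intros k Hk; apply unif_cv_ext with (3 := unif_cv_plus _ _ _ _ (H k Hk) (K k Hk)).
  + generalize (filter_and _ _ S1 S3); apply filter_imp; intros t [A B] x; symmetry.
    now apply Derive_n_plus; apply smooth_all_locally.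
  + intros x; symmetry; now apply Derive_n_plus; apply smooth_all_locally.
Qed.

(** By (u v)' = u' v + u v', order n + 1 of the product needs order n of two products of other
    functions; hence the induction is quantified over all four functions. *)
Lemma cv_upto_mult (n : nat) (u v : T -> R -> R) (f g : R -> R) :
  cv_upto F n u f -> cv_upto F n v g -> cv_upto F n (fun t x => u t x * v t x) (fun x => f x * g x).
Proof.
revert u v f g; induction n as [|n IH]; intros u v f g H K.
all: assert (S : F (fun t => smooth (fun x => u t x * v t x)))
  by (generalize (filter_and _ _ (proj1 H) (proj1 K)); apply filter_imp; intros t [A B]; now apply smooth_mult).
all: assert (S' : smooth (fun x => f x * g x)) by (apply smooth_mult; [apply H | apply K]).
all: assert (U : unif_cv F (fun t x => u t x * v t x) (fun x => f x * g x))
  by (apply unif_cv_mult; [apply H | apply K | eapply cv_upto_unif, H | eapply cv_upto_unif, K]).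
- now apply cv_upto_0.
- apply cv_upto_S; auto.
  assert (H' := cv_upto_le n (Datatypes.S n) u f ltac:(lia) H).
  assert (K' := cv_upto_le n (Datatypes.S n) v g ltac:(lia) K).
  apply cv_upto_Derive in H as DH; apply cv_upto_Derive in K as DK.
  apply cv_upto_ext with (3 := cv_upto_plus n _ _ _ _ (IH _ _ _ _ DH K') (IH _ _ _ _ H' DK)).
  + generalize (filter_and _ _ (proj1 H) (proj1 K)); apply filter_imp; intros t [A B] x.
    symmetry; apply Derive_mult; now apply smooth_ex_derive.
  + intros x; symmetry; apply Derive_mult; apply smooth_ex_derive; [apply H | apply K].
Qed.

Lemma cv_upto_const (n : nat) (f : R -> R) : smooth f -> cv_upto F n (fun _ => f) f.
Proof.
intros Sf; split; [|split]; auto; [now apply filter_forall|].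
intros k _; apply (unif_cv_const (Derive_n f k)).
Qed.

Lemma Derive_inv_pos (f : R -> R) (x : R) : smooth f -> (forall x, 0 < f x) ->
  Derive (fun x => / f x) x = -1 * (Derive f x * (/ f x * / f x)).
Proof.
intros Sf P; specialize (P x); apply is_derive_unique.
evar_last; [apply is_derive_inv; [now apply Derive_correct, smooth_ex_derive | lra]|]; field; lra.
Qed.

Lemma Derive_sqrt_pos (f : R -> R) (x : R) : smooth f -> (forall x, 0 < f x) ->
  Derive (fun x => sqrt (f x)) x = / 2 * (Derive f x * / sqrt (f x)).
Proof.
intros Sf P; specialize (P x); apply is_derive_unique.
evar_last; [apply is_derive_sqrt; [now apply Derive_correct, smooth_ex_derive | lra]|].
simpl; field; now apply Rgt_not_eq, sqrt_lt_R0.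
Qed.

Lemma cv_upto_inv (n : nat) (u : T -> R -> R) (f : R -> R) :
  F (fun t => forall x, 0 < u t x) -> (forall x, 0 < f x) ->
  cv_upto F n u f -> cv_upto F n (fun t x => / u t x) (fun x => / f x).
Proof.
intros Pu Pf; revert u f Pu Pf; induction n as [|n IH]; intros u f Pu Pf H.
all: assert (PS := filter_and _ _ Pu (proj1 H)).
all: assert (S : F (fun t => smooth (fun x => / u t x)))
  by (revert PS; apply filter_imp; intros t [A B]; now apply smooth_inv).
all: assert (S' : smooth (fun x => / f x)) by (apply smooth_inv; [apply H | apply Pf]).
all: assert (U : unif_cv F (fun t x => / u t x) (fun x => / f x))
  by (apply unif_cv_inv; [apply H | apply Pf | eapply cv_upto_unif, H]).
- now apply cv_upto_0.
- apply cv_upto_S; auto.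
  assert (H' := IH _ _ Pu Pf (cv_upto_le n (Datatypes.S n) u f ltac:(lia) H)).
  apply cv_upto_Derive in H as DH.
  apply cv_upto_ext with (3 := cv_upto_mult n _ _ _ _ (cv_upto_const n _ (smooth_const (-1)))
    (cv_upto_mult n _ _ _ _ DH (cv_upto_mult n _ _ _ _ H' H'))).
  + revert PS; apply filter_imp; intros t [A B] x; symmetry; now apply Derive_inv_pos.
  + intros x; symmetry; apply Derive_inv_pos; [apply H | apply Pf].
Qed.

Lemma cv_upto_sqrt (n : nat) (u : T -> R -> R) (f : R -> R) :
  F (fun t => forall x, 0 < u t x) -> (forall x, 0 < f x) ->
  cv_upto F n u f -> cv_upto F n (fun t x => sqrt (u t x)) (fun x => sqrt (f x)).
Proof.
intros Pu Pf; revert u f Pu Pf; induction n as [|n IH]; intros u f Pu Pf H.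
all: assert (PS := filter_and _ _ Pu (proj1 H)).
all: assert (S : F (fun t => smooth (fun x => sqrt (u t x))))
  by (revert PS; apply filter_imp; intros t [A B]; now apply smooth_sqrt).
all: assert (S' : smooth (fun x => sqrt (f x))) by (apply smooth_sqrt; [apply H | apply Pf]).
all: assert (U : unif_cv F (fun t x => sqrt (u t x)) (fun x => sqrt (f x)))
  by (apply unif_cv_sqrt; [apply H | apply Pf | eapply cv_upto_unif, H]).
- now apply cv_upto_0.
- apply cv_upto_S; auto.
  assert (H' := IH _ _ Pu Pf (cv_upto_le n (Datatypes.S n) u f ltac:(lia) H)).
  apply cv_upto_Derive in H as DH.
  assert (HI : cv_upto F n (fun t x => / sqrt (u t x)) (fun x => / sqrt (f x))).
  { apply (cv_upto_inv n (fun t x => sqrt (u t x))); [| |exact H'].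
    - revert Pu; apply filter_imp; intros t A x; now apply sqrt_lt_R0.
    - intros x; now apply sqrt_lt_R0. }
  apply cv_upto_ext with (3 := cv_upto_mult n _ _ _ _ (cv_upto_const n _ (smooth_const (/ 2)))
    (cv_upto_mult n _ _ _ _ DH HI)).
  + revert PS; apply filter_imp; intros t [A B] x; symmetry; now apply Derive_sqrt_pos.
  + intros x; symmetry; apply Derive_sqrt_pos; [apply H | apply Pf].
Qed.

Lemma cv_all_ext (u v : T -> R -> R) (f g : R -> R) :
  F (fun t => forall x, u t x = v t x) -> (forall x, f x = g x) ->
  cv_all F u f -> cv_all F v g.
Proof. intros E1 E2 H n; now apply cv_upto_ext with u f. Qed.

Lemma cv_all_const (f : R -> R) : smooth f -> cv_all F (fun _ => f) f.
Proof. intros Sf n; now apply cv_upto_const. Qed.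

Lemma cv_all_plus (u v : T -> R -> R) (f g : R -> R) :
  cv_all F u f -> cv_all F v g -> cv_all F (fun t x => u t x + v t x) (fun x => f x + g x).
Proof. intros H K n; now apply cv_upto_plus. Qed.

Lemma cv_all_mult (u v : T -> R -> R) (f g : R -> R) :
  cv_all F u f -> cv_all F v g -> cv_all F (fun t x => u t x * v t x) (fun x => f x * g x).
Proof. intros H K n; now apply cv_upto_mult. Qed.

Lemma cv_all_scal (a : R) (u : T -> R -> R) (f : R -> R) :
  cv_all F u f -> cv_all F (fun t x => a * u t x) (fun x => a * f x).
Proof. intros H; apply cv_all_mult; [apply cv_all_const, smooth_const | exact H]. Qed.

Lemma cv_all_inv (u : T -> R -> R) (f : R -> R) :
  F (fun t => forall x, 0 < u t x) -> (forall x, 0 < f x) ->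
  cv_all F u f -> cv_all F (fun t x => / u t x) (fun x => / f x).
Proof. intros Pu Pf H n; now apply cv_upto_inv. Qed.

Lemma cv_all_sqrt (u : T -> R -> R) (f : R -> R) :
  F (fun t => forall x, 0 < u t x) -> (forall x, 0 < f x) ->
  cv_all F u f -> cv_all F (fun t x => sqrt (u t x)) (fun x => sqrt (f x)).
Proof. intros Pu Pf H n; now apply cv_upto_sqrt. Qed.

Lemma cv_all_Derive (u : T -> R -> R) (f : R -> R) :
  cv_all F u f -> cv_all F (fun t => Derive (u t)) (Derive f).
Proof. intros H n; now apply cv_upto_Derive. Qed.

(** Integration gains one order: order n + 1 of the primitive is order n of the integrand, and order
    0 is the uniform estimate for integrals. *)
Lemma cv_all_RInt (u : T -> R -> R) (f : R -> R) :
  cv_all F u f -> cv_all F (fun t x => RInt (u t) 0 x) (fun x => RInt f 0 x).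
Proof.
intros H; destruct (H 0%nat) as (S1 & S2 & _); intros n.
apply cv_upto_le with (S n); [lia|]; apply cv_upto_S.
- revert S1; apply filter_imp; intros t; apply smooth_RInt.
- now apply smooth_RInt.
- apply unif_cv_RInt; auto; apply (cv_upto_unif 0), H.
- apply cv_upto_ext with (3 := H n).
  + revert S1; apply filter_imp; intros t A x; symmetry; now apply Derive_smooth_RInt.
  + intros x; symmetry; now apply Derive_smooth_RInt.
Qed.

Lemma cv_all_filterlim (u : T -> smooth_fun) (f : smooth_fun) :
  cv_all F (fun t => u t) f -> filterlim u F (locally f).
Proof.
intros H P [eps HP].
assert (Pe := cond_pos eps).
(* The ball of radius [eps] sees only orders k < 1 / eps < n + 1, hence finitely many. *)
destruct (nfloor_ex (/ eps)) as [n Hn]; [now left; apply Rinv_0_lt_compat|].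
destruct (H (S n)) as (_ & _ & K).
(* A filter is closed under finite intersections only, so the conditions for the separate orders are
   collected by induction. *)
assert (Q : forall m, (m <= S n)%nat -> F (fun t => forall k, (k <= m)%nat -> forall x,
  Rabs x <= / eps -> Rabs (Derive_n (u t) k x - Derive_n f k x) < eps)).
{ induction m as [|m IH]; intros Hm.
  - generalize (K 0%nat ltac:(lia) (/ eps) eps Pe); apply filter_imp.
    intros t A k Hk; now replace k with 0%nat by lia.
  - generalize (filter_and (F := F) _ _ (IH ltac:(lia)) (K (S m) Hm (/ eps) eps Pe)); apply filter_imp.
    intros t [A B] k Hk; destruct (Nat.eq_dec k (S m)) as [->|]; [exact B | apply A; lia]. }
unfold filtermap; generalize (Q (S n) (le_n _)); apply filter_imp; intros t A.
apply HP; intros k x Hk Hx.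
assert (lt_inv : forall y, y * eps < 1 -> y < / eps).
{ intros y Hy; apply Rmult_lt_reg_r with eps; [exact Pe|]; rewrite Rinv_l; lra. }
apply A; [|now left; apply lt_inv].
apply INR_le; rewrite S_INR; apply lt_inv in Hk; lra.
Qed.

Lemma filterlim_cv_all (u : T -> smooth_fun) (f : smooth_fun) :
  filterlim u F (locally f) -> cv_all F (fun t => u t) f.
Proof.
intros H n; split; [|split]; [apply filter_forall; intros t; apply smooth_mapP | apply smooth_mapP|].
intros k _ M eps He.
assert (HM := Rabs_pos M); assert (Hk := pos_INR k).
(* The second bound makes order k and all |x| <= M visible to the ball of radius d: both [INR k * d]
   and [Rabs x * d] are below 1. *)
set (d := Rmin eps (/ (INR k + Rabs M + 1))).
assert (Hd : 0 < d) by (apply Rmin_pos; [lra | apply Rinv_0_lt_compat; lra]).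
assert (D1 : d <= eps) by apply Rmin_l.
assert (D2 : (INR k + Rabs M + 1) * d <= 1).
{ apply Rle_trans with ((INR k + Rabs M + 1) * / (INR k + Rabs M + 1)).
  - apply Rmult_le_compat_l; [lra | apply Rmin_r].
  - right; field; lra. }
assert (L : locally f (fun g => smooth_fun_ball f d g)) by (exists (mkposreal d Hd); intros g Hg; exact Hg).
assert (HL : F (fun t => smooth_fun_ball f d (u t))) by exact (H _ L).
revert HL; apply filter_imp; intros t A x Hx.
assert (h := Rle_abs M); assert (Px := Rabs_pos x).
apply Rlt_le_trans with d; [|exact D1]; apply A; nra.
Qed.

End Convergence.

(** * Velocities and smooth paths *)

Lemma filterlim_pair_iff {T : Type} {U W : UniformSpace} (F : (T -> Prop) -> Prop) {FF : Filter F}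
    (u : T -> U * W) (l : U * W) :
  filterlim u F (locally l) <->
  filterlim (fun t => fst (u t)) F (locally (fst l)) /\
  filterlim (fun t => snd (u t)) F (locally (snd l)).
Proof.
rewrite !filterlim_locally; split.
- intros H; split; intros eps; generalize (H eps); apply filter_imp; intros t [A B]; assumption.
- intros [H K] eps; generalize (filter_and _ _ (H eps) (K eps)); apply filter_imp.
  intros t [A B]; now split.
Qed.

Section PathsInPairs.

Context {E G : NormedModuleAux R_AbsRing}.

Let EG := prod_NormedModuleAux R_AbsRing E G.

Lemma is_velocity_pair (gamma : R -> EG) (t : R) (v : EG) :
  is_velocity gamma t v <->
  is_velocity (fun t => fst (gamma t)) t (fst v) /\ is_velocity (fun t => snd (gamma t)) t (snd v).
Proof. apply (filterlim_pair_iff (locally' 0)). Qed.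

Lemma smooth_path_pair (gamma : R -> EG) :
  smooth_path gamma <->
  smooth_path (fun t => fst (gamma t)) /\ smooth_path (fun t => snd (gamma t)).
Proof.
split.
- intros (D & D0 & DS); split.
  + exists (fun n t => fst (D n t)); split; [intros t; now rewrite D0|].
    intros k t; now apply (is_velocity_pair (D k) t (D (S k) t)).
  + exists (fun n t => snd (D n t)); split; [intros t; now rewrite D0|].
    intros k t; now apply (is_velocity_pair (D k) t (D (S k) t)).
- intros [(D & D0 & DS) (D' & D0' & DS')].
  exists (fun n t => (D n t, D' n t)); split.
  + intros t; rewrite D0, D0'; now destruct (gamma t).
  + intros k t; apply is_velocity_pair; split; [apply DS | apply DS'].
Qed.

End PathsInPairs.

(** The witness is a whole sequence of velocities, whereas the hypothesis only asserts that each
    next one exists. Dependent choice, by recursion on elements of [P] bundled with their membership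
    proof, produces the sequence. *)
Lemma smooth_path_of_class {E : NormedModuleAux R_AbsRing} (P : (R -> E) -> Prop) :
  (forall gamma, P gamma -> exists v, P v /\ forall t, is_velocity gamma t (v t)) ->
  forall gamma, P gamma -> smooth_path gamma.
Proof.
intros H gamma Hg.
assert (next : forall g : {g | P g}, {v : {v | P v} |
  forall t, is_velocity (proj1_sig g) t (proj1_sig v t)}).
{ intros [g Pg]; apply constructive_indefinite_description.
  destruct (H g Pg) as (v & Pv & Hv); now exists (exist _ v Pv). }
set (D := fix D n := match n with 0%nat => exist _ gamma Hg | S n => proj1_sig (next (D n)) end).
exists (fun n => proj1_sig (D n)); split; [reflexivity|].
intros k t; exact (proj2_sig (next (D k)) t).
Qed.

Lemma smooth_path_velocity {E : NormedModuleAux R_AbsRing} (gamma : R -> E) : smooth_path gamma ->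
  exists v, smooth_path v /\ forall t, is_velocity gamma t (v t).
Proof.
intros (D & D0 & DS); exists (D 1%nat); split.
- exists (fun n => D (S n)); split; [reflexivity | intros k; apply DS].
- assert (E0 : D 0%nat = gamma) by (apply FunctionalExtensionality.functional_extensionality, D0).
  rewrite <- E0; apply DS.
Qed.

(** * Rules for velocities in the space of smooth functions *)

Definition quotients (gamma : R -> smooth_fun) (t h x : R) : R :=
  / h * (gamma (t + h) x - gamma t x).

Lemma is_velocity_cv (gamma : R -> smooth_fun) (t : R) (v : smooth_fun) :
  is_velocity gamma t v <-> cv_all (locally' 0) (quotients gamma t) v.
Proof.
split; intros H.
- apply (filterlim_cv_all (locally' 0) _ _ H).
- apply (cv_all_filterlim (locally' 0)
    (fun h : R => scal (/ h) (minus (gamma (t + h)) (gamma t)))); exact H.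
Qed.

Lemma locally'_neq (P : R -> Prop) : (forall h, h <> 0 -> P h) -> locally' 0 P.
Proof. intros H; exists (mkposreal 1 Rlt_0_1); intros y _; apply H. Qed.

Lemma cv_all_id : cv_all (locally' 0) (fun h _ => h) (fun _ => 0).
Proof.
intros n; split; [|split].
- apply filter_forall; intros h; apply smooth_const.
- apply smooth_const.
- intros k _ M eps He; exists (mkposreal eps He); intros h Hh _ x _.
  destruct k as [|k].
  + exact Hh.
  + rewrite !Derive_n_const, Rminus_0_r, Rabs_R0; exact He.
Qed.

(** Differentiability gives continuity: gamma (t + h) = gamma t + h q, where the difference quotient
    q converges and h tends to 0. *)
Lemma velocity_cv (gamma : R -> smooth_fun) (t : R) (v : smooth_fun) : is_velocity gamma t v ->
  cv_all (locally' 0) (fun h => gamma (t + h)) (gamma t).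
Proof.
intros H; apply is_velocity_cv in H.
apply cv_all_ext with (u := fun h x => gamma t x + h * quotients gamma t h x)
  (f := fun x => gamma t x + 0 * v x); try typeclasses eauto.
- apply locally'_neq; intros h Hh x; unfold quotients; field; exact Hh.
- intros x; ring.
- apply (cv_all_plus (locally' 0) (fun _ => gamma t)).
  + apply (cv_all_const (locally' 0)), smooth_mapP.
  + apply (cv_all_mult (locally' 0)); [apply cv_all_id | exact H].
Qed.

(** Here and in the rules below, the resulting path and velocity enter through pointwise equations,
    because elements of [smooth_fun] carry smoothness proofs and the rule should fit any of them. *)
Lemma velocity_plus (gamma eta delta : R -> smooth_fun) (t : R) (v w z : smooth_fun) :
  (forall t x, delta t x = gamma t x + eta t x) -> (forall x, z x = v x + w x) ->
  is_velocity gamma t v -> is_velocity eta t w -> is_velocity delta t z.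
Proof.
intros Ed Ez Hv Hw; apply is_velocity_cv in Hv, Hw; apply is_velocity_cv.
apply cv_all_ext with (4 := cv_all_plus (locally' 0) _ _ _ _ Hv Hw); try typeclasses eauto; auto.
apply filter_forall; intros h x; unfold quotients; rewrite !Ed; ring.
Qed.

Lemma velocity_mult (gamma eta delta : R -> smooth_fun) (t : R) (v w z : smooth_fun) :
  (forall t x, delta t x = gamma t x * eta t x) ->
  (forall x, z x = v x * eta t x + gamma t x * w x) ->
  is_velocity gamma t v -> is_velocity eta t w -> is_velocity delta t z.
Proof.
intros Ed Ez Hv Hw; assert (Ce := velocity_cv _ _ _ Hw).
apply is_velocity_cv in Hv, Hw; apply is_velocity_cv.
apply cv_all_ext with (4 := cv_all_plus (locally' 0) _ _ _ _
  (cv_all_mult (locally' 0) _ _ _ _ Hv Ce)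
  (cv_all_mult (locally' 0) _ _ _ _ (cv_all_const (locally' 0) _ (smooth_mapP (gamma t))) Hw));
  try typeclasses eauto; auto.
apply filter_forall; intros h x; unfold quotients; rewrite !Ed; ring.
Qed.

Lemma velocity_const (f z : smooth_fun) (t : R) :
  (forall x, z x = 0) -> is_velocity (fun _ => f) t z.
Proof.
intros Ez; apply is_velocity_cv.
apply cv_all_ext with (4 := cv_all_const (locally' 0) _ (smooth_const 0)); try typeclasses eauto; auto.
apply filter_forall; intros h x; unfold quotients; ring.
Qed.

Lemma velocity_Derive (gamma delta : R -> smooth_fun) (t : R) (v z : smooth_fun) :
  (forall t x, delta t x = Derive (gamma t) x) -> (forall x, z x = Derive v x) ->
  is_velocity gamma t v -> is_velocity delta t z.
Proof.
intros Ed Ez Hv; apply is_velocity_cv in Hv; apply is_velocity_cv.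
apply cv_all_ext with (4 := cv_all_Derive (locally' 0) _ _ Hv); try typeclasses eauto; auto.
apply filter_forall; intros h x; unfold quotients; rewrite !Ed.
rewrite Derive_scal, Derive_minus; auto; apply smooth_ex_derive, smooth_mapP.
Qed.

Lemma velocity_RInt (gamma delta : R -> smooth_fun) (t : R) (v z : smooth_fun) :
  (forall t x, delta t x = RInt (gamma t) 0 x) -> (forall x, z x = RInt v 0 x) ->
  is_velocity gamma t v -> is_velocity delta t z.
Proof.
intros Ed Ez Hv; apply is_velocity_cv in Hv; apply is_velocity_cv.
apply cv_all_ext with (4 := cv_all_RInt (locally' 0) _ _ Hv); try typeclasses eauto; auto.
apply filter_forall; intros h x; unfold quotients; rewrite !Ed.
assert (S := smooth_minus _ _ (smooth_mapP (gamma (t + h))) (smooth_mapP (gamma t))).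
rewrite (RInt_smooth_scal _ _ _ _ S), RInt_smooth_minus; auto; apply smooth_mapP.
Qed.

Lemma velocity_inv (gamma delta : R -> smooth_fun) (t : R) (v z : smooth_fun) :
  (forall t x, 0 < gamma t x) ->
  (forall t x, delta t x = / gamma t x) ->
  (forall x, z x = - 1 * (v x * (/ gamma t x * / gamma t x))) ->
  is_velocity gamma t v -> is_velocity delta t z.
Proof.
intros P Ed Ez Hv; assert (Cg := velocity_cv _ _ _ Hv).
apply is_velocity_cv in Hv; apply is_velocity_cv.
assert (Ci := cv_all_inv (locally' 0) _ _ (filter_forall _ (fun h => P (t + h))) (P t) Cg).
(* With q the quotient of gamma, the quotient of 1 / gamma is - q / (gamma t * gamma (t + h)); its
   limit needs only the continuity of 1 / gamma. *)
apply cv_all_ext with (4 := cv_all_scal (locally' 0) (-1) _ _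
  (cv_all_mult (locally' 0) _ _ _ _ Hv
  (cv_all_mult (locally' 0) _ _ _ _ (cv_all_const (locally' 0) _ (smooth_inv _ (smooth_mapP (gamma t)) (P t))) Ci)));
  try typeclasses eauto; auto.
apply locally'_neq; intros h Hh x; unfold quotients; rewrite !Ed.
assert (P1 := P t x); assert (P2 := P (t + h) x); field; lra.
Qed.

Lemma velocity_sqrt (gamma delta : R -> smooth_fun) (t : R) (v z : smooth_fun) :
  (forall t x, 0 < gamma t x) ->
  (forall t x, delta t x = sqrt (gamma t x)) ->
  (forall x, z x = / 2 * (v x * / sqrt (gamma t x))) ->
  is_velocity gamma t v -> is_velocity delta t z.
Proof.
intros P Ed Ez Hv; assert (Cg := velocity_cv _ _ _ Hv).
apply is_velocity_cv in Hv; apply is_velocity_cv.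
assert (P' : forall t x, 0 < sqrt (gamma t x)) by (intros s x; apply sqrt_lt_R0, P).
assert (Cs := cv_all_sqrt (locally' 0) _ _ (filter_forall _ (fun h => P (t + h))) (P t) Cg).
(* Multiplication by the conjugate turns the quotient of sqrt gamma into q / (sqrt (gamma (t + h)) +
   sqrt (gamma t)), so continuity of the root suffices and the sum in the denominator is
   positive. *)
assert (Cp := cv_all_plus (locally' 0) _ _ _ _ Cs
  (cv_all_const (locally' 0) _ (smooth_sqrt _ (smooth_mapP (gamma t)) (P t)))).
assert (Ci := cv_all_inv (locally' 0) _ _
  (filter_forall _ (fun h x => Rplus_lt_0_compat _ _ (P' (t + h) x) (P' t x)))
  (fun x => Rplus_lt_0_compat _ _ (P' t x) (P' t x)) Cp).
apply cv_all_ext with (4 := cv_all_mult (locally' 0) _ _ _ _ Hv Ci); try typeclasses eauto.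
- apply locally'_neq; intros h Hh x; unfold quotients; rewrite !Ed.
  assert (P1 := P' t x); assert (P2 := P' (t + h) x).
  rewrite <- (sqrt_sqrt (gamma (t + h) x)) at 1 by (left; apply P).
  rewrite <- (sqrt_sqrt (gamma t x)) at 1 by (left; apply P).
  field; lra.
- intros x; rewrite Ez; assert (P1 := P' t x); field; lra.
Qed.

(** The counterpart of [smooth_expr] for paths: the velocity of each constructor is again such an
    expression. The operations in x, differentiation and integration, commute with the velocity.
    Results are specified pointwise to remain independent of smoothness proofs. *)
Inductive path_expr : (R -> smooth_fun) -> Prop :=
| pe_smooth (gamma : R -> smooth_fun) : smooth_path gamma -> path_expr gamma
| pe_const f : path_expr (fun _ => f)
| pe_plus (gamma eta delta : R -> smooth_fun) : path_expr gamma -> path_expr eta ->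
    (forall t x, delta t x = gamma t x + eta t x) -> path_expr delta
| pe_mult (gamma eta delta : R -> smooth_fun) : path_expr gamma -> path_expr eta ->
    (forall t x, delta t x = gamma t x * eta t x) -> path_expr delta
| pe_inv (gamma delta : R -> smooth_fun) : path_expr gamma -> (forall t x, 0 < gamma t x) ->
    (forall t x, delta t x = / gamma t x) -> path_expr delta
| pe_sqrt (gamma delta : R -> smooth_fun) : path_expr gamma -> (forall t x, 0 < gamma t x) ->
    (forall t x, delta t x = sqrt (gamma t x)) -> path_expr delta
| pe_Derive (gamma delta : R -> smooth_fun) : path_expr gamma ->
    (forall t x, delta t x = Derive (gamma t) x) -> path_expr delta
| pe_RInt (gamma delta : R -> smooth_fun) : path_expr gamma ->
    (forall t x, delta t x = RInt (gamma t) 0 x) -> path_expr delta.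

Definition sf_mult (f g : smooth_fun) : smooth_fun :=
  SmoothFun (smooth_mult (smooth_mapP f) (smooth_mapP g)).
Definition sf_Derive (f : smooth_fun) : smooth_fun := SmoothFun (smooth_Derive (smooth_mapP f)).
Definition sf_RInt (f : smooth_fun) : smooth_fun := SmoothFun (smooth_RInt 0 (smooth_mapP f)).

Lemma path_expr_smooth (gamma : R -> smooth_fun) : path_expr gamma -> smooth_path gamma.
Proof.
revert gamma; apply smooth_path_of_class; intros gamma Hg.
induction Hg as [gamma Hg | f | g e d Hg (g' & Gg & Dg) He (e' & Ge & De) Ed
  | g e d Hg (g' & Gg & Dg) He (e' & Ge & De) Ed
  | g d Hg (g' & Gg & Dg) P Ed | g d Hg (g' & Gg & Dg) P Ed
  | g d Hg (g' & Gg & Dg) Ed | g d Hg (g' & Gg & Dg) Ed].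
- destruct (smooth_path_velocity _ Hg) as (v & Sv & Hv); exists v; split; [now apply pe_smooth | exact Hv].
- exists (fun _ => smooth_fun_zero); split; [apply pe_const|].
  intros t; now apply velocity_const.
- exists (fun t => smooth_fun_plus (g' t) (e' t)); split; [now apply pe_plus with g' e'|].
  intros t; now apply velocity_plus with (3 := Dg t) (4 := De t).
- exists (fun t => smooth_fun_plus (sf_mult (g' t) (e t)) (sf_mult (g t) (e' t))); split.
  + apply pe_plus with (fun t => sf_mult (g' t) (e t)) (fun t => sf_mult (g t) (e' t)); [| |reflexivity].
    * now apply pe_mult with g' e.
    * now apply pe_mult with g e'.
  + intros t; now apply velocity_mult with (3 := Dg t) (4 := De t).
(* The velocity - g' / g^2 is written with the path d = 1 / g itself, so it remains inside the
   class. *)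
- exists (fun t => smooth_fun_scal (-1) (sf_mult (g' t) (sf_mult (d t) (d t)))); split.
  + apply pe_mult with (fun _ => SmoothFun (smooth_const (-1))) (fun t => sf_mult (g' t) (sf_mult (d t) (d t)));
      [apply pe_const | | reflexivity].
    apply pe_mult with g' (fun t => sf_mult (d t) (d t)); [exact Gg | | reflexivity].
    assert (pe_d : path_expr d) by now apply pe_inv with g.
    now apply pe_mult with d d.
  + intros t; apply velocity_inv with (4 := Dg t); auto.
    intros x; simpl; now rewrite Ed.
- assert (pe_d : path_expr d) by now apply pe_sqrt with g.
  assert (P' : forall t x, 0 < d t x) by (intros t x; rewrite Ed; apply sqrt_lt_R0, P).
  set (i := fun t => SmoothFun (smooth_inv _ (smooth_mapP (d t)) (P' t))).
  assert (pe_i : path_expr i) by now apply pe_inv with d.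
  exists (fun t => smooth_fun_scal (/ 2) (sf_mult (g' t) (i t))); split.
  + apply pe_mult with (fun _ => SmoothFun (smooth_const (/ 2))) (fun t => sf_mult (g' t) (i t));
      [apply pe_const | | reflexivity].
    now apply pe_mult with g' i.
  + intros t; apply velocity_sqrt with (4 := Dg t); auto.
    intros x; simpl; now rewrite Ed.
- exists (fun t => sf_Derive (g' t)); split; [now apply pe_Derive with g'|].
  intros t; now apply velocity_Derive with (3 := Dg t).
- exists (fun t => sf_RInt (g' t)); split; [now apply pe_RInt with g'|].
  intros t; now apply velocity_RInt with (3 := Dg t).
Qed.

Lemma is_velocity_unique (gamma : R -> smooth_fun) (t : R) (v w : smooth_fun) :
  is_velocity gamma t v -> is_velocity gamma t w -> v = w.
Proof.
intros Hv Hw; apply is_velocity_cv in Hv, Hw; apply smooth_fun_eq; intros x.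
apply cond_eq; intros eps He.
assert (He2 : 0 < eps / 2) by lra.
destruct (Hv 0%nat) as (_ & _ & Kv); destruct (Hw 0%nat) as (_ & _ & Kw).
specialize (Kv 0%nat (le_n _) (Rabs x) _ He2); specialize (Kw 0%nat (le_n _) (Rabs x) _ He2).
(* Punctured neighbourhoods of 0 are nonempty, so a single difference quotient lies within eps / 2
   of both limits at x. *)
destruct (filter_ex (F := Rbar_locally' (Finite 0)) _ (filter_and (F := locally' 0) _ _ Kv Kw)) as [h [A B]].
specialize (A x (Rle_refl _)); specialize (B x (Rle_refl _)); simpl in A, B.
apply Rabs_lt_between in A, B; apply Rabs_lt_between; lra.
Qed.

(** This allows formulas in (t, x) to be composed as plain real functions, with the smoothness
    proofs in x hidden in the realising path. *)
Definition path_fn (u : R -> R -> R) : Prop :=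
  exists gamma : R -> smooth_fun, path_expr gamma /\ forall t x, gamma t x = u t x.

Lemma path_fn_smooth (gamma : R -> smooth_fun) : path_fn gamma -> smooth_path gamma.
Proof.
intros (d & Hd & Ed); apply path_expr_smooth.
replace gamma with d; [exact Hd|].
apply FunctionalExtensionality.functional_extensionality; intros t; apply smooth_fun_eq, Ed.
Qed.

Lemma smooth_path_fn (gamma : R -> smooth_fun) : smooth_path gamma -> path_fn gamma.
Proof. intros H; exists gamma; split; [now apply pe_smooth | reflexivity]. Qed.

Lemma path_fn_const (f : R -> R) : smooth f -> path_fn (fun _ => f).
Proof. intros H; exists (fun _ => SmoothFun H); split; [apply pe_const | reflexivity]. Qed.

Lemma path_fn_plus (u v : R -> R -> R) : path_fn u -> path_fn v ->
  path_fn (fun t x => u t x + v t x).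
Proof.
intros (g & Hg & Eg) (d & Hd & Ed); exists (fun t => smooth_fun_plus (g t) (d t)); split.
- now apply pe_plus with g d.
- intros t x; simpl; now rewrite Eg, Ed.
Qed.

Lemma path_fn_mult (u v : R -> R -> R) : path_fn u -> path_fn v ->
  path_fn (fun t x => u t x * v t x).
Proof.
intros (g & Hg & Eg) (d & Hd & Ed); exists (fun t => sf_mult (g t) (d t)); split.
- now apply pe_mult with g d.
- intros t x; simpl; now rewrite Eg, Ed.
Qed.

Lemma path_fn_ext (u v : R -> R -> R) : (forall t x, u t x = v t x) -> path_fn u -> path_fn v.
Proof. intros E (g & Hg & Eg); exists g; split; [exact Hg | intros t x; now rewrite Eg]. Qed.

Lemma path_fn_scal (a : R) (u : R -> R -> R) : path_fn u -> path_fn (fun t x => a * u t x).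
Proof. apply (path_fn_mult (fun _ _ => a)), path_fn_const, smooth_const. Qed.

Lemma path_fn_minus (u v : R -> R -> R) : path_fn u -> path_fn v ->
  path_fn (fun t x => u t x - v t x).
Proof.
intros Hu Hv; apply path_fn_ext with (2 := path_fn_plus _ _ Hu (path_fn_scal (-1) _ Hv)).
intros t x; ring.
Qed.

Lemma path_fn_inv (u : R -> R -> R) : (forall t x, 0 < u t x) -> path_fn u ->
  path_fn (fun t x => / u t x).
Proof.
intros P (g & Hg & Eg).
assert (P' : forall t x, 0 < g t x) by (intros t x; now rewrite Eg).
exists (fun t => SmoothFun (smooth_inv _ (smooth_mapP (g t)) (P' t))); split.
- now apply pe_inv with g.
- intros t x; simpl; now rewrite Eg.
Qed.

Lemma path_fn_sqrt (u : R -> R -> R) : (forall t x, 0 < u t x) -> path_fn u ->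
  path_fn (fun t x => sqrt (u t x)).
Proof.
intros P (g & Hg & Eg).
assert (P' : forall t x, 0 < g t x) by (intros t x; now rewrite Eg).
exists (fun t => SmoothFun (smooth_sqrt _ (smooth_mapP (g t)) (P' t))); split.
- now apply pe_sqrt with g.
- intros t x; simpl; now rewrite Eg.
Qed.

Lemma path_fn_Derive (u : R -> R -> R) : path_fn u -> path_fn (fun t => Derive (u t)).
Proof.
intros (g & Hg & Eg); exists (fun t => sf_Derive (g t)); split.
- now apply pe_Derive with g.
- intros t x; apply Derive_ext, Eg.
Qed.

Lemma path_fn_RInt (u : R -> R -> R) : path_fn u -> path_fn (fun t x => RInt (u t) 0 x).
Proof.
intros (g & Hg & Eg); exists (fun t => sf_RInt (g t)); split.
- now apply pe_RInt with g.
- intros t x; apply RInt_ext_all, Eg.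
Qed.

(** * Continuous choice of angle *)

Lemma is_derive_zero_const (f : R -> R) : (forall x, is_derive f x 0) -> forall x y, f x = f y.
Proof.
intros D.
assert (L : forall x y, x < y -> f x = f y).
{ intros x y H; apply (eq_is_derive (V := R_NormedModule) f x y); [intros t _; apply D | exact H]. }
intros x y; destruct (Rtotal_order x y) as [H|[->|H]]; [now apply L | reflexivity | now symmetry; apply L].
Qed.

Lemma cos_eq_1_small (u : R) : cos u = 1 -> Rabs u < 1 -> u = 0.
Proof.
intros C H; apply Rabs_lt_between in H.
replace u with (2 * (u / 2)) in C by lra; rewrite cos_2a_sin in C.
assert (S : sin (u / 2) = 0) by nra.
assert (P := PI2_1).
destruct (Rtotal_order u 0) as [N|[N|N]]; [|exact N|].
- assert (sin (u / 2) < 0) by (apply sin_lt_0_var; lra); lra.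
- assert (0 < sin (u / 2)) by (apply sin_gt_0; lra); lra.
Qed.

Lemma cos_eq_1_sin (u : R) : cos u = 1 -> sin u = 0.
Proof. intros C; assert (H := sin2_cos2 u); unfold Rsqr in H; rewrite C in H; nra. Qed.

(** The values of phi are multiples of 2 pi, and by continuity nearby values differ by less than 1,
    hence not at all. So phi is locally constant and its derivative vanishes. *)
Lemma cos_eq_1_const (phi : R -> R) : (forall x, continuous phi x) -> (forall x, cos (phi x) = 1) ->
  forall x y, phi x = phi y.
Proof.
intros Hc H1; apply is_derive_zero_const; intros x.
apply is_derive_ext_loc with (fun _ => phi x); [|apply @is_derive_const].
destruct (proj1 (filterlim_locally phi (phi x)) (Hc x) (mkposreal 1 Rlt_0_1)) as [d Hd].
exists d; intros y Hy; specialize (Hd y Hy).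
assert (E : phi y - phi x = 0).
{ apply cos_eq_1_small; [|exact Hd].
  rewrite cos_minus, !H1, !cos_eq_1_sin by apply H1; ring. }
lra.
Qed.

Lemma polar_angle (a b : R) : 0 < a * a + b * b ->
  exists t, a = sqrt (a * a + b * b) * cos t /\ b = sqrt (a * a + b * b) * sin t.
Proof.
intros P; set (r := sqrt (a * a + b * b)).
assert (Pr : 0 < r) by now apply sqrt_lt_R0.
assert (Er : r * r = a * a + b * b) by (apply sqrt_sqrt; lra).
assert (B : -1 <= a / r <= 1).
{ split; apply Rmult_le_reg_r with r; try lra; unfold Rdiv; rewrite Rmult_assoc, Rinv_l by lra; nra. }
assert (Ec : r * (a / r) = a) by (field; lra).
assert (Es : r * sqrt (1 - Rsqr (a / r)) = Rabs b).
{ rewrite <- (Rabs_pos_eq r) at 1 by lra.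
  rewrite <- sqrt_Rsqr_abs, <- sqrt_mult_alt by apply Rle_0_sqr.
  rewrite <- sqrt_Rsqr_abs; f_equal; unfold Rsqr.
  replace (r * r * (1 - a / r * (a / r))) with (r * r - a * a) by (field; lra); lra. }
(* [acos] takes values in [0, pi], where the sine is nonnegative; a negative b needs the opposite
   angle. *)
destruct (Rle_lt_dec 0 b) as [Hb|Hb].
- exists (acos (a / r)); rewrite cos_acos, sin_acos by exact B.
  rewrite Ec, Es, Rabs_pos_eq by exact Hb; now split.
- exists (- acos (a / r)); rewrite cos_neg, sin_neg, cos_acos, sin_acos by exact B.
  rewrite Ec, <- Ropp_mult_distr_r, Es, Rabs_left by exact Hb; split; ring.
Qed.

Lemma sum_sqr_nonneg (a b : R) : 0 <= a * a + b * b.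
Proof. apply Rplus_le_le_0_compat; apply Rle_0_sqr. Qed.

Lemma sum_sqr_pos (a b : R) : ~ (a = 0 /\ b = 0) -> 0 < a * a + b * b.
Proof.
intros H; destruct (Req_dec a 0) as [Ha|Ha]; [destruct (Req_dec b 0) as [Hb|Hb]|]; [tauto | nra | nra].
Qed.

(* The angle is a primitive of [(a b' - b a') / (a^2 + b^2)]; rotating [(a, b)] back by it
   and dividing by its length gives a constant vector. *)
Lemma angle_lift (a b : R -> R) (t0 : R) : smooth a -> smooth b ->
  (forall x, 0 < a x * a x + b x * b x) ->
  a 0 = sqrt (a 0 * a 0 + b 0 * b 0) * cos t0 ->
  b 0 = sqrt (a 0 * a 0 + b 0 * b 0) * sin t0 ->
  exists beta, smooth beta /\ beta 0 = t0 /\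
    forall x, a x = sqrt (a x * a x + b x * b x) * cos (beta x) /\
              b x = sqrt (a x * a x + b x * b x) * sin (beta x).
Proof.
intros Sa Sb P Ea Eb.
set (rho := fun x => a x * a x + b x * b x).
assert (Srho : smooth rho) by (apply smooth_plus; now apply smooth_mult).
set (w := fun x => (a x * Derive b x - b x * Derive a x) * / rho x).
assert (Sw : smooth w).
{ apply smooth_mult; [|now apply smooth_inv].
  apply smooth_minus; apply smooth_mult; auto; now apply smooth_Derive. }
set (beta := fun x => t0 + RInt w 0 x).
assert (Sbeta : smooth beta) by (apply smooth_plus; [apply smooth_const | now apply smooth_RInt]).
assert (Db : forall x, Derive beta x = w x).
{ intros x; unfold beta; rewrite Derive_plus, Derive_const, Derive_smooth_RInt; auto.
  - ring.
  - apply ex_derive_const.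
  - apply smooth_ex_derive, smooth_RInt, Sw. }
assert (B0 : beta 0 = t0).
{ unfold beta; rewrite RInt_point; unfold zero; simpl; ring. }
assert (Da := fun x => smooth_ex_derive x Sa); assert (Db' := fun x => smooth_ex_derive x Sb).
assert (Dbeta := fun x => smooth_ex_derive x Sbeta).
set (r := fun x => sqrt (rho x)).
assert (Pr : forall x, 0 < r x) by (intros x; apply sqrt_lt_R0, P).
assert (Er : forall x, r x * r x = rho x) by (intros x; apply sqrt_sqrt; left; apply P).
assert (Dr : forall x, Derive r x = (a x * Derive a x + b x * Derive b x) * / r x).
{ intros x; unfold r; rewrite Derive_sqrt_pos by (assumption || apply P).
  unfold rho at 1; rewrite Derive_plus by (apply smooth_ex_derive; now apply smooth_mult).
  rewrite !Derive_mult by auto; field; apply Rgt_not_eq, Pr. }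
assert (Exr := fun x => smooth_ex_derive x (smooth_sqrt rho Srho P)); fold r in Exr.
(* [X] and [Y] below treat the two coordinates of the vector rotated back and normalised. *)
assert (X : forall x y, (a x * cos (beta x) + b x * sin (beta x)) / r x
                      = (a y * cos (beta y) + b y * sin (beta y)) / r y).
{ apply (is_derive_zero_const (fun x => (a x * cos (beta x) + b x * sin (beta x)) / r x)); intros x.
  auto_derive; [repeat split; auto; apply Rgt_not_eq, Pr|].
  change (Derive (fun x => a x)) with (Derive a); change (Derive (fun x => b x)) with (Derive b).
  change (Derive (fun x => r x)) with (Derive r); change (Derive (fun x => beta x)) with (Derive beta).
  rewrite Dr, Db; unfold w; rewrite <- Er.
  assert (H := Pr x); assert (H2 := Er x); unfold rho in H2.
  apply Rmult_eq_reg_r with (r x * r x * r x);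
    [|apply Rgt_not_eq; repeat apply Rmult_lt_0_compat; exact H].
  field_simplify; [|lra..].
  replace (r x ^ 2) with (a x * a x + b x * b x) by (rewrite <- H2; ring); ring. }
assert (Y : forall x y, (b x * cos (beta x) - a x * sin (beta x)) / r x
                      = (b y * cos (beta y) - a y * sin (beta y)) / r y).
{ apply (is_derive_zero_const (fun x => (b x * cos (beta x) - a x * sin (beta x)) / r x)); intros x.
  auto_derive; [repeat split; auto; apply Rgt_not_eq, Pr|].
  change (Derive (fun x => a x)) with (Derive a); change (Derive (fun x => b x)) with (Derive b).
  change (Derive (fun x => r x)) with (Derive r); change (Derive (fun x => beta x)) with (Derive beta).
  rewrite Dr, Db; unfold w; rewrite <- Er.
  assert (H := Pr x); assert (H2 := Er x); unfold rho in H2.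
  apply Rmult_eq_reg_r with (r x * r x * r x);
    [|apply Rgt_not_eq; repeat apply Rmult_lt_0_compat; exact H].
  field_simplify; [|lra..].
  replace (r x ^ 2) with (a x * a x + b x * b x) by (rewrite <- H2; ring); ring. }
exists beta; split; [exact Sbeta|]; split; [exact B0|]; intros x.
fold (rho x); fold (r x); fold (rho 0) in Ea, Eb; fold (r 0) in Ea, Eb.
assert (H := Pr x); assert (H0 := Pr 0).
assert (T0 := sin2_cos2 t0); assert (Tx := sin2_cos2 (beta x)); unfold Rsqr in T0, Tx.
(* By the choice of [t0] the constant vector is (1, 0); rotating it forward by [beta x] gives the
   claim. *)
specialize (X x 0); specialize (Y x 0); rewrite B0, Ea, Eb in X, Y.
replace ((r 0 * cos t0 * cos t0 + r 0 * sin t0 * sin t0) / r 0) with (sin t0 * sin t0 + cos t0 * cos t0)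
  in X by (field; lra).
replace ((r 0 * sin t0 * cos t0 - r 0 * cos t0 * sin t0) / r 0) with 0 in Y by (field; lra).
rewrite T0 in X.
assert (X' : a x * cos (beta x) + b x * sin (beta x) = r x).
{ rewrite <- (Rmult_1_l (r x)), <- X; field; lra. }
assert (Y' : b x * cos (beta x) - a x * sin (beta x) = 0).
{ rewrite <- (Rmult_0_l (r x)), <- Y; field; lra. }
split.
- transitivity ((a x * cos (beta x) + b x * sin (beta x)) * cos (beta x)
    - (b x * cos (beta x) - a x * sin (beta x)) * sin (beta x)); [|rewrite X', Y'; ring].
  transitivity (a x * (sin (beta x) * sin (beta x) + cos (beta x) * cos (beta x))); [rewrite Tx|]; ring.
- transitivity ((a x * cos (beta x) + b x * sin (beta x)) * sin (beta x)
    + (b x * cos (beta x) - a x * sin (beta x)) * cos (beta x)); [|rewrite X', Y'; ring].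
  transitivity (b x * (sin (beta x) * sin (beta x) + cos (beta x) * cos (beta x))); [rewrite Tx|]; ring.
Qed.

(** * Square roots of the velocity of a curve *)

(** The multiplier of f under translation by a full turn. As its square is 1, products of two
    elements of V are periodic, and both parities are handled by the same computation. *)
Definition sg (s : parity) : R := match s with ev => 1 | od => -1 end.

Lemma V_sg (s : parity) (f : smooth_fun) : V s f <-> forall x, f (x + 2 * PI) = sg s * f x.
Proof. destruct s; unfold V, sg; split; intros H x; rewrite H; ring. Qed.

Lemma sg_sqr (s : parity) : sg s * sg s = 1.
Proof. destruct s; simpl; ring. Qed.

Lemma Derive_shift (f : R -> R) (a x : R) : smooth f ->
  Derive (fun y => f (y + a)) x = Derive f (x + a).
Proof.
intros Sf; apply is_derive_unique.
evar_last; [apply (is_derive_comp f (fun y => y + a));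
  [apply Derive_correct; now apply smooth_ex_derive | auto_derive; [exact I | reflexivity]]|].
unfold scal; simpl; unfold mult; simpl; ring.
Qed.

Lemma Derive_periodic (f : R -> R) (a k : R) : smooth f ->
  (forall x, f (x + a) = k * f x) -> forall x, Derive f (x + a) = k * Derive f x.
Proof.
intros Sf H x; rewrite <- Derive_shift by exact Sf.
rewrite <- Derive_scal; now apply Derive_ext.
Qed.

Lemma smooth_fun_Derive_periodic (f : smooth_fun) : (forall x, f (x + 2 * PI) = f x) ->
  forall x, Derive f (x + 2 * PI) = Derive f x.
Proof.
intros H x; rewrite (Derive_periodic _ (2 * PI) 1); [ring | apply smooth_mapP|].
intros y; now rewrite H, Rmult_1_l.
Qed.

(** The difference f (x + a) - f x has zero derivative, and its value at 0 is zero. *)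
Lemma periodic_of_Derive (f : R -> R) (a : R) : smooth f ->
  (forall x, Derive f (x + a) = Derive f x) -> f a = f 0 -> forall x, f (x + a) = f x.
Proof.
intros Sf H H0 x; apply Rminus_diag_uniq.
transitivity (f (0 + a) - f 0); [|rewrite Rplus_0_l; lra].
apply (is_derive_zero_const (fun x => f (x + a) - f x)); intros y.
replace 0 with (Derive f (y + a) - Derive f y) by (rewrite H; ring).
apply (is_derive_minus (fun x => f (x + a)) f).
- rewrite <- Derive_shift by exact Sf; apply Derive_correct.
  eexists; apply (is_derive_comp f (fun y => y + a));
  [apply Derive_correct; now apply smooth_ex_derive | auto_derive; [exact I | reflexivity]].
- now apply Derive_correct, smooth_ex_derive.
Qed.

Lemma periodic_iff (c : smooth_pair) : periodic c <->
  (forall x, fst c (x + 2 * PI) = fst c x) /\ (forall x, snd c (x + 2 * PI) = snd c x).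
Proof.
unfold periodic, to_C; split; [intros H; split; intros x; now injection (H x)|].
intros [H K] x; now rewrite H, K.
Qed.

Lemma C_deriv_nonzero (c : smooth_pair) (x : R) : C_deriv c x <> 0%C <->
  0 < Derive (fst c) x * Derive (fst c) x + Derive (snd c) x * Derive (snd c) x.
Proof.
unfold C_deriv; split.
- intros H; apply sum_sqr_pos; intros [A B]; apply H; now rewrite A, B.
- intros H E; injection E as A B; rewrite A, B in H; lra.
Qed.

Lemma Cmod_pair (a b : R) : Cmod (a, b) = sqrt (a * a + b * b).
Proof. unfold Cmod; simpl; f_equal; ring. Qed.

(* [c' = (e + if)^2 / 2] for [p = (e, f)]. *)
Definition velocity_root (p c : smooth_pair) : Prop := forall x,
  Derive (fst c) x = / 2 * (fst p x * fst p x - snd p x * snd p x) /\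
  Derive (snd c) x = fst p x * snd p x.

Lemma velocity_root_Cmod (p c : smooth_pair) (x : R) : velocity_root p c ->
  Cmod (C_deriv c x) = / 2 * (fst p x * fst p x + snd p x * snd p x).
Proof.
intros H; destruct (H x) as [A B]; unfold C_deriv; rewrite Cmod_pair, A, B.
apply sqrt_lem_1; nra.
Qed.

Lemma Phi_fst (p : smooth_pair) (x : R) :
  fst (Phi p) x = / 2 * RInt (fun x => fst p x * fst p x + - (snd p x * snd p x)) 0 x.
Proof. change (Re (Phi_curve p x) = / 2 * RInt (fun x => fst p x * fst p x + - (snd p x * snd p x)) 0 x);
  now rewrite Phi_curveE. Qed.

Lemma Phi_snd (p : smooth_pair) (x : R) :
  snd (Phi p) x = / 2 * RInt (fun x => 2 * (fst p x * snd p x)) 0 x.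
Proof. change (Im (Phi_curve p x) = / 2 * RInt (fun x => 2 * (fst p x * snd p x)) 0 x);
  now rewrite Phi_curveE. Qed.

Lemma smooth_sqr_diff (p : smooth_pair) :
  smooth (fun x => fst p x * fst p x + - (snd p x * snd p x)).
Proof. apply smooth_plus; [|apply smooth_opp]; apply smooth_mult; apply smooth_mapP. Qed.

Lemma smooth_two_prod (p : smooth_pair) : smooth (fun x => 2 * (fst p x * snd p x)).
Proof. apply smooth_scal, smooth_mult; apply smooth_mapP. Qed.

Lemma Phi_velocity_root (p : smooth_pair) : velocity_root p (Phi p).
Proof.
intros x; split.
- rewrite (Derive_ext _ _ _ (Phi_fst p)), Derive_scal, Derive_smooth_RInt by apply smooth_sqr_diff; ring.
- rewrite (Derive_ext _ _ _ (Phi_snd p)), Derive_scal, Derive_smooth_RInt by apply smooth_two_prod; field.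
Qed.

Lemma Phi_0 (p : smooth_pair) : fst (Phi p) 0 = 0 /\ snd (Phi p) 0 = 0.
Proof.
split; [rewrite Phi_fst | rewrite Phi_snd]; rewrite RInt_point; unfold zero; simpl; ring.
Qed.

Lemma smooth_fun_eq_Derive (f g : smooth_fun) : f 0 = g 0 ->
  (forall x, Derive f x = Derive g x) -> f = g.
Proof.
intros E H; apply smooth_fun_eq; intros x.
assert (A := RInt_Derive_smooth f 0 x (smooth_mapP f)).
assert (B := RInt_Derive_smooth g 0 x (smooth_mapP g)).
rewrite (RInt_ext (Derive f) (Derive g)) in A by (intros; apply H); lra.
Qed.

Lemma velocity_root_Phi (p c : smooth_pair) : velocity_root p c -> to_C c 0 = 0%C -> Phi p = c.
Proof.
intros H E; injection E as E1 E2; destruct (Phi_0 p) as [P1 P2].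
assert (K := Phi_velocity_root p).
rewrite (surjective_pairing (Phi p)), (surjective_pairing c); f_equal; apply smooth_fun_eq_Derive.
- now rewrite P1, E1.
- intros x; now rewrite (proj1 (H x)), (proj1 (K x)).
- now rewrite P2, E2.
- intros x; now rewrite (proj2 (H x)), (proj2 (K x)).
Qed.

(** These three linear relations are used in both directions: orthonormality of (e, f) amounts to
    length 1 together with the two closing equations. *)
Lemma velocity_root_integrals (p c : smooth_pair) : velocity_root p c ->
  curve_length c = / 2 * (inner (fst p) (fst p) + inner (snd p) (snd p)) /\
  fst c (2 * PI) - fst c 0 = / 2 * (inner (fst p) (fst p) - inner (snd p) (snd p)) /\
  snd c (2 * PI) - snd c 0 = inner (fst p) (snd p).
Proof.
intros H.
assert (S1 : smooth (fun x => fst p x * fst p x)) by (apply smooth_mult; apply smooth_mapP).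
assert (S2 : smooth (fun x => snd p x * snd p x)) by (apply smooth_mult; apply smooth_mapP).
unfold inner; split; [|split].
- rewrite <- RInt_smooth_plus, <- RInt_smooth_scal by (assumption || now apply smooth_plus).
  unfold curve_length; apply RInt_ext_all; intros x; now apply velocity_root_Cmod.
- rewrite <- RInt_smooth_minus, <- RInt_smooth_scal by (assumption || now apply smooth_minus).
  rewrite <- RInt_Derive_smooth by apply smooth_mapP.
  apply RInt_ext_all; intros x; apply H.
- rewrite <- RInt_Derive_smooth by apply smooth_mapP.
  apply RInt_ext_all; intros x; apply H.
Qed.

Lemma velocity_root_St0 (s : parity) (p c : smooth_pair) : velocity_root p c ->
  based_unit_curves s c -> V s (fst p) -> V s (snd p) -> St0 s p.
Proof.
intros H ((Pc & Nc & _) & _ & Lc) Ve Vf.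
destruct (velocity_root_integrals p c H) as (L & I1 & I2).
apply periodic_iff in Pc; destruct Pc as [P1 P2].
specialize (P1 0); specialize (P2 0); rewrite Rplus_0_l in P1, P2.
rewrite Lc in L; rewrite P1 in I1; rewrite P2 in I2.
split; [repeat split; auto; lra|].
intros x [E F]; specialize (Nc x); apply C_deriv_nonzero in Nc.
destruct (H x) as [A B]; rewrite A, B, E, F in Nc; lra.
Qed.

Lemma IZR_PI_trig (k : Z) : sin (IZR k * PI) = 0 /\ cos (2 * (IZR k * PI)) = 1.
Proof.
assert (S : sin (IZR k * PI) = 0) by (apply sin_eq_0_1; now exists k).
split; [exact S|]; rewrite cos_2a_sin, S; ring.
Qed.

Lemma cos_sin_parity (s : parity) (d : Z) : match s with ev => Z.Even d | od => Z.Odd d end ->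
  cos (IZR d * PI) = sg s /\ sin (IZR d * PI) = 0.
Proof.
intros H; split; [|apply IZR_PI_trig].
destruct s, H as [k ->]; unfold sg.
- rewrite mult_IZR, Rmult_assoc; apply IZR_PI_trig.
- rewrite plus_IZR, mult_IZR.
  replace ((2 * IZR k + 1) * PI) with (2 * (IZR k * PI) + PI) by ring.
  rewrite neg_cos, (proj2 (IZR_PI_trig k)); reflexivity.
Qed.

(** Half-angle formulas turn the condition into a zero of the sine (even case) or of the cosine (odd
    case) at u / 2, and the known zeros have the right parity. *)
Lemma cos_sg_parity (s : parity) (u : R) : cos u = sg s ->
  exists d, u = IZR d * PI /\ match s with ev => Z.Even d | od => Z.Odd d end.
Proof.
intros H; replace u with (2 * (u / 2)) in H by lra; destruct s; simpl in H.
- rewrite cos_2a_sin in H; assert (S : sin (u / 2) = 0) by nra.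
  apply sin_eq_0_0 in S; destruct S as [k Hk]; exists (2 * k)%Z; split; [|now exists k].
  rewrite mult_IZR; lra.
- rewrite cos_2a_cos in H; assert (S : cos (u / 2) = 0) by nra.
  apply cos_eq_0_0 in S; destruct S as [k Hk]; exists (2 * k + 1)%Z; split; [|now exists k].
  rewrite plus_IZR, mult_IZR; lra.
Qed.

Lemma Phi_based_unit_curves (s : parity) (p : smooth_pair) :
  St0 s p -> based_unit_curves s (Phi p).
Proof.
intros ((Ve & Vf & E1 & F1 & EF) & NZ).
assert (H := Phi_velocity_root p).
destruct (velocity_root_integrals p _ H) as (L & I1 & I2); rewrite E1, F1 in L, I1; rewrite EF in I2.
destruct (Phi_0 p) as [Z1 Z2]; rewrite Z1 in I1; rewrite Z2 in I2.
rewrite V_sg in Ve, Vf.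
assert (P : forall x, 0 < fst p x * fst p x + snd p x * snd p x) by (intros x; apply sum_sqr_pos, NZ).
assert (SS := sg_sqr s).
split; [split; [|split]|split; [unfold to_C; now rewrite Z1, Z2 | lra]].
- apply periodic_iff; split; apply periodic_of_Derive; try apply smooth_mapP; try lra;
  intros x; [rewrite !(proj1 (H _)) | rewrite !(proj2 (H _))]; rewrite Ve, Vf;
  [transitivity (/ 2 * ((sg s * sg s) * (fst p x * fst p x - snd p x * snd p x)))
  |transitivity ((sg s * sg s) * (fst p x * snd p x))]; try ring; rewrite SS; ring.
- intros x; apply C_deriv_nonzero; destruct (H x) as [A B]; rewrite A, B; specialize (P x); nra.
- destruct (polar_angle (fst p 0) (snd p 0) (P 0)) as (t0 & A0 & B0).
  destruct (angle_lift (fst p) (snd p) t0 (smooth_mapP _) (smooth_mapP _) P A0 B0) as (b & Sb & b0 & Hb).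
  set (r := fun x => sqrt (fst p x * fst p x + snd p x * snd p x)).
  change (forall x, fst p x = r x * cos (b x) /\ snd p x = r x * sin (b x)) in Hb.
  assert (Pr : forall x, 0 < r x) by (intros x; apply sqrt_lt_R0, P).
  assert (Er : forall x, r x * r x = fst p x * fst p x + snd p x * snd p x)
    by (intros x; apply sqrt_sqrt; left; apply P).
  (* Since z (2 pi) = sg s * z 0, the two vectors have the same length, and their scalar product
     shows that the cosine of the angle increment is [sg s]. *)
  destruct (cos_sg_parity s (b (2 * PI) - b 0)) as (d & Ed & Pd).
  { assert (Ve0 := Ve 0); assert (Vf0 := Vf 0); rewrite Rplus_0_l in Ve0, Vf0.
    assert (R0 : r (2 * PI) = r 0).
    { unfold r; rewrite Ve0, Vf0; f_equal.
      transitivity ((sg s * sg s) * (fst p 0 * fst p 0 + snd p 0 * snd p 0)); [ring | rewrite SS; ring]. }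
    apply Rmult_eq_reg_l with (r 0 * r 0); [|specialize (Pr 0); nra].
    transitivity (sg s * (fst p 0 * fst p 0 + snd p 0 * snd p 0)); [|rewrite <- Er; ring].
    transitivity (fst p (2 * PI) * fst p 0 + snd p (2 * PI) * snd p 0); [|rewrite Ve0, Vf0; ring].
    rewrite cos_minus, (proj1 (Hb 0)), (proj2 (Hb 0)), (proj1 (Hb (2 * PI))), (proj2 (Hb (2 * PI))).
    rewrite R0; ring. }
  exists d; split; [|exact Pd].
  exists (fun x => 2 * b x); split; [|split].
  + intros x; now apply smooth_continuous, smooth_scal.
  + intros x; rewrite (velocity_root_Cmod p) by exact H; rewrite <- Er.
    destruct (H x) as [A B]; destruct (Hb x) as [C D]; unfold C_deriv; rewrite A, B.
    unfold Cmult; simpl; rewrite cos_2a, sin_2a.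
    f_equal; rewrite C, D; field.
  + rewrite <- Rmult_minus_distr_l, Ed; ring.
Qed.

Lemma exists_velocity_root (s : parity) (c : smooth_pair) : Imm s c ->
  exists p, velocity_root p c /\ V s (fst p) /\ V s (snd p).
Proof.
intros (Pc & Nc & d & (al & Ca & Ha & Wa) & Pd).
apply periodic_iff in Pc; destruct Pc as [P1 P2].
(* The factor 2 is there because the sought z satisfies z^2 = 2 c'. *)
set (a := fun x => 2 * Derive (fst c) x); set (b := fun x => 2 * Derive (snd c) x).
assert (Sa : smooth a) by apply smooth_scal, smooth_Derive, smooth_mapP.
assert (Sb : smooth b) by apply smooth_scal, smooth_Derive, smooth_mapP.
assert (Pa : forall x, a (x + 2 * PI) = a x).
{ intros x; unfold a; now rewrite smooth_fun_Derive_periodic. }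
assert (Pb : forall x, b (x + 2 * PI) = b x).
{ intros x; unfold b; now rewrite smooth_fun_Derive_periodic. }
assert (P : forall x, 0 < a x * a x + b x * b x).
{ intros x; specialize (Nc x); apply C_deriv_nonzero in Nc; unfold a, b; nra. }
set (r := fun x => sqrt (a x * a x + b x * b x)).
assert (Pr : forall x, 0 < r x) by (intros x; apply sqrt_lt_R0, P).
assert (Er : forall x, r x * r x = a x * a x + b x * b x) by (intros x; apply sqrt_sqrt; left; apply P).
assert (Rp : forall x, r (x + 2 * PI) = r x) by (intros x; unfold r; now rewrite Pa, Pb).
assert (Hal : forall x, a x = r x * cos (al x) /\ b x = r x * sin (al x)).
{ intros x; specialize (Ha x).
  assert (M : Cmod (C_deriv c x) = / 2 * r x).
  { unfold C_deriv; rewrite Cmod_pair; apply sqrt_lem_1.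
    - specialize (Nc x); apply C_deriv_nonzero in Nc; lra.
    - specialize (Pr x); lra.
    - transitivity (/ 4 * (r x * r x)); [field | rewrite Er; unfold a, b; field]. }
  rewrite M in Ha; unfold C_deriv, Cmult in Ha; simpl in Ha; injection Ha as A B.
  unfold a, b; rewrite A, B; split; field. }
(* The angle [al] supplied by the winding number is only continuous. It is replaced by a smooth
   angle [be] with the same value at 0. *)
destruct (angle_lift a b (al 0) Sa Sb P) as (be & Sbe & be0 & Hbe); [apply Hal | apply Hal|].
assert (Cbe : forall x, continuous be x) by (intros x; now apply smooth_continuous).
(* Both functions are angles of the same vector, so al - be is a continuous function with values in
   the multiples of 2 pi, hence constant; [be] has the increment of [al]. *)
assert (Hw : be (2 * PI) - be 0 = 2 * (IZR d * PI)).
{ assert (E : al (2 * PI) - be (2 * PI) = al 0 - be 0).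
  { apply (cos_eq_1_const (fun x => al x - be x)).
    - intros x; apply (continuous_minus (V := R_NormedModule)); [apply Ca | apply Cbe].
    - intros x; destruct (Hal x) as [A B]; destruct (Hbe x) as [A' B']; fold (r x) in A', B'.
      apply Rmult_eq_reg_l with (r x * r x); [|specialize (Pr x); nra].
      transitivity ((r x * cos (al x)) * (r x * cos (be x)) + (r x * sin (al x)) * (r x * sin (be x)));
        [rewrite cos_minus; ring|].
      now rewrite <- A, <- B, <- A', <- B', Rmult_1_r, Er. }
  lra. }
(* The winding number gives the increment only between 0 and 2 pi. As c' is periodic, the increment
   over a full turn starting anywhere is a continuous multiple of 2 pi, hence constant. *)
assert (Hp : forall x, be (x + 2 * PI) = be x + 2 * (IZR d * PI)).
{ intros x; assert (E : be (x + 2 * PI) - be x = be (0 + 2 * PI) - be 0).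
  { apply (cos_eq_1_const (fun x => be (x + 2 * PI) - be x)).
    - intros y; apply (continuous_minus (V := R_NormedModule)); [|apply Cbe].
      apply (continuous_comp (fun y => y + 2 * PI) be); [|apply Cbe].
      apply (continuous_plus (V := R_NormedModule)); [apply continuous_id | apply continuous_const].
    - intros y; destruct (Hbe y) as [A B]; destruct (Hbe (y + 2 * PI)) as [A' B'].
      fold (r y) in A, B; fold (r (y + 2 * PI)) in A', B'; rewrite Rp, Pa in A'; rewrite Rp, Pb in B'.
      apply Rmult_eq_reg_l with (r y * r y); [|specialize (Pr y); nra].
      transitivity ((r y * cos (be (y + 2 * PI))) * (r y * cos (be y))
        + (r y * sin (be (y + 2 * PI))) * (r y * sin (be y))); [rewrite cos_minus; ring|].
      rewrite <- A, <- B, <- A', <- B', Rmult_1_r; now rewrite Er. }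
  rewrite Rplus_0_l, Hw in E; lra. }
set (q := fun x => sqrt (r x)).
assert (Sr : smooth r) by (apply smooth_sqrt; [apply smooth_plus; now apply smooth_mult | exact P]).
assert (Sq : smooth q) by (apply smooth_sqrt; [exact Sr | exact Pr]).
assert (Eq : forall x, q x * q x = r x) by (intros x; apply sqrt_sqrt; left; apply Pr).
assert (S2 : smooth (fun x => / 2 * be x)) by now apply smooth_scal.
destruct (cos_sin_parity s d Pd) as [Cd Sd].
assert (Hh : forall x, / 2 * be (x + 2 * PI) = / 2 * be x + IZR d * PI) by (intros x; rewrite Hp; field).
(* This is z = sqrt |2 c'| exp (i be / 2). Over a full turn its angle grows by d pi, which
   multiplies it by (-1)^d, that is by [sg s]. *)
exists (SmoothFun (smooth_mult Sq (smooth_cos _ S2)), SmoothFun (smooth_mult Sq (smooth_sin _ S2))).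
split; [|split].
- intros x; destruct (Hbe x) as [A B]; fold (r x) in A, B; simpl.
  replace (be x) with (2 * (/ 2 * be x)) in A, B by field.
  rewrite cos_2a, <- Eq in A; rewrite sin_2a, <- Eq in B; split.
  + transitivity (/ 2 * a x); [unfold a; field | rewrite A; ring].
  + transitivity (/ 2 * b x); [unfold b; field | rewrite B; field].
- rewrite V_sg; intros x; simpl; rewrite Hh, cos_plus, Cd, Sd; unfold q; rewrite Rp; ring.
- rewrite V_sg; intros x; simpl; rewrite Hh, sin_plus, Cd, Sd; unfold q; rewrite Rp; ring.
Qed.

(** * The differential of Phi *)

(** Integrating this two-sided estimate replaces differentiation under the integral sign. It holds
    for every t, even where the displaced vector vanishes and its modulus is not differentiable. *)
Lemma length_first_order (a b u v t : R) : 0 < a * a + b * b ->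
  let m := sqrt (a * a + b * b) in
  let s := sqrt ((a + t * u) * (a + t * u) + (b + t * v) * (b + t * v)) in
  m + t * ((a * u + b * v) * / m) <= s <=
  m + t * ((a * u + b * v) * / m) + t * t * ((u * u + v * v) * / (2 * m)).
Proof.
intros P m s.
assert (Pm : 0 < m) by now apply sqrt_lt_R0.
assert (Em : m * m = a * a + b * b) by (apply sqrt_sqrt; lra).
assert (Ps : 0 <= s) by apply sqrt_pos.
assert (Es : s * s = (a + t * u) * (a + t * u) + (b + t * v) * (b + t * v))
  by (apply sqrt_sqrt, sum_sqr_nonneg).
split; apply Rmult_le_reg_l with m; try exact Pm.
- (* Cauchy-Schwarz *)
  replace (m * (m + t * ((a * u + b * v) * / m))) with (a * (a + t * u) + b * (b + t * v))
    by (transitivity (m * m + t * (a * u + b * v)); [rewrite Em; ring | field; lra]).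
  destruct (Rle_lt_dec (a * (a + t * u) + b * (b + t * v)) 0) as [N|N]; [nra|].
  apply Rsqr_incr_0_var; [|nra]; unfold Rsqr.
  replace (m * s * (m * s)) with ((m * m) * (s * s)) by ring; rewrite Em, Es.
  assert (0 <= Rsqr (a * (b + t * v) - b * (a + t * u))) by apply Rle_0_sqr; unfold Rsqr in H; nra.
- (* AM-GM: [2 m s <= m^2 + s^2] *)
  replace (m * (m + t * ((a * u + b * v) * / m) + t * t * ((u * u + v * v) * / (2 * m))))
    with (/ 2 * (m * m + s * s)).
  + assert (0 <= Rsqr (m - s)) by apply Rle_0_sqr; unfold Rsqr in H; nra.
  + rewrite Es; transitivity (m * m + t * (a * u + b * v) + t * t * (u * u + v * v) * / 2);
      [rewrite Em; field | field; lra].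
Qed.

Lemma is_derive_of_quadratic_bound (f : R -> R) (l K : R) :
  (forall t, f 0 + t * l <= f t <= f 0 + t * l + t * t * K) -> is_derive f 0 l.
Proof.
intros H; apply is_derive_Reals; intros eps He.
assert (PK := Rabs_pos K); assert (LK := Rle_abs K).
assert (Hd : 0 < eps / (Rabs K + 1)) by (apply Rdiv_lt_0_compat; lra).
exists (mkposreal _ Hd); intros t Ht Lt; simpl in Lt; rewrite Rplus_0_l.
replace ((f t - f 0) / t - l) with ((f t - f 0 - t * l) / t) by (field; exact Ht).
unfold Rdiv; rewrite Rabs_mult, Rabs_inv.
assert (Pt := Rabs_pos_lt t Ht).
apply Rmult_lt_reg_r with (Rabs t); [exact Pt|].
rewrite Rmult_assoc, Rinv_l, Rmult_1_r by lra.
assert (B : Rabs (f t - f 0 - t * l) <= Rabs t * Rabs t * Rabs K).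
{ specialize (H t); rewrite Rabs_pos_eq by lra.
  rewrite <- Rabs_mult, (Rabs_pos_eq (t * t)) by nra; nra. }
assert (Rabs t * (Rabs K + 1) < eps).
{ replace eps with (eps / (Rabs K + 1) * (Rabs K + 1)) by (field; lra).
  apply Rmult_lt_compat_r; lra. }
nra.
Qed.

Lemma C_deriv_line (c h : smooth_pair) (t x : R) :
  C_deriv (plus c (scal t h)) x =
  (Derive (fst c) x + t * Derive (fst h) x, Derive (snd c) x + t * Derive (snd h) x).
Proof.
assert (L : forall f g : smooth_fun, Derive (fun x => f x + t * g x) x = Derive f x + t * Derive g x).
{ intros f g; rewrite Derive_plus, Derive_scal; [reflexivity | apply smooth_ex_derive, smooth_mapP |].
  apply smooth_ex_derive, smooth_scal, smooth_mapP. }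
apply (f_equal2 pair (L (fst c) (fst h)) (L (snd c) (snd h))).
Qed.

Lemma curve_length_derivative (c h : smooth_pair) : (forall x, C_deriv c x <> 0%C) ->
  is_derive (fun t => curve_length (plus c (scal t h))) 0
    (RInt (fun x => (Derive (fst c) x * Derive (fst h) x + Derive (snd c) x * Derive (snd h) x)
                    * / Cmod (C_deriv c x)) 0 (2 * PI)).
Proof.
intros Nc.
set (a := Derive (fst c)); set (b := Derive (snd c)).
set (u := Derive (fst h)); set (v := Derive (snd h)).
assert (Sa : smooth a) by apply smooth_Derive, smooth_mapP.
assert (Sb : smooth b) by apply smooth_Derive, smooth_mapP.
assert (Su : smooth u) by apply smooth_Derive, smooth_mapP.
assert (Sv : smooth v) by apply smooth_Derive, smooth_mapP.
assert (P : forall x, 0 < a x * a x + b x * b x) by (intros x; apply C_deriv_nonzero, Nc).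
set (m := fun x => sqrt (a x * a x + b x * b x)).
assert (Pm : forall x, 0 < m x) by (intros x; apply sqrt_lt_R0, P).
assert (Sm : smooth m) by (apply smooth_sqrt; [apply smooth_plus; now apply smooth_mult | exact P]).
set (s := fun t x => sqrt ((a x + t * u x) * (a x + t * u x) + (b x + t * v x) * (b x + t * v x))).
assert (Sl1 : forall t, smooth (fun x => a x + t * u x)) by (intros t; apply smooth_plus; [exact Sa | now apply smooth_scal]).
assert (Sl2 : forall t, smooth (fun x => b x + t * v x)) by (intros t; apply smooth_plus; [exact Sb | now apply smooth_scal]).
assert (Es : forall t, curve_length (plus c (scal t h)) = RInt (s t) 0 (2 * PI)).
{ intros t; unfold curve_length; apply RInt_ext_all; intros x; now rewrite C_deriv_line, Cmod_pair. }
(* The displaced curve need not be immersed, so its speed is only known to be continuous, which is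
   enough for integrability. *)
assert (Is : forall t, ex_RInt (s t) 0 (2 * PI)).
{ intros t; apply (ex_RInt_continuous (V := R_CompleteNormedModule)); intros x _.
  apply (continuous_comp (fun x => (a x + t * u x) * (a x + t * u x) + (b x + t * v x) * (b x + t * v x)) sqrt).
  - apply smooth_continuous, smooth_plus; now apply smooth_mult.
  - apply continuity_pt_filterlim, continuity_pt_sqrt, sum_sqr_nonneg. }
set (p := fun x => (a x * u x + b x * v x) * / m x).
set (q := fun x => (u x * u x + v x * v x) * / (2 * m x)).
assert (Sp : smooth p) by (apply smooth_mult; [apply smooth_plus; now apply smooth_mult | now apply smooth_inv]).
assert (Sq : smooth q).
{ apply smooth_mult; [apply smooth_plus; now apply smooth_mult | apply smooth_inv; [now apply smooth_scal|]].
  intros x; specialize (Pm x); lra. }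
assert (I0 : RInt (s 0) 0 (2 * PI) = RInt m 0 (2 * PI)).
{ apply RInt_ext_all; intros x; unfold s, m; f_equal; ring. }
assert (PI0 := PI_RGT_0).
rewrite (RInt_ext _ p) by (intros x _; unfold p, C_deriv; now rewrite Cmod_pair).
apply is_derive_of_quadratic_bound with (RInt q 0 (2 * PI)); intros t.
rewrite !Es, I0.
assert (St : smooth (fun x => t * p x)) by now apply smooth_scal.
assert (Sq2 : smooth (fun x => t * t * q x)) by now apply smooth_scal.
assert (Smt : smooth (fun x => m x + t * p x)) by now apply smooth_plus.
assert (Sup : smooth (fun x => m x + t * p x + t * t * q x)) by now apply smooth_plus.
assert (Elow : RInt m 0 (2 * PI) + t * RInt p 0 (2 * PI) = RInt (fun x => m x + t * p x) 0 (2 * PI)).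
{ rewrite RInt_smooth_plus, RInt_smooth_scal by assumption; reflexivity. }
assert (Eup : RInt m 0 (2 * PI) + t * RInt p 0 (2 * PI) + t * t * RInt q 0 (2 * PI)
  = RInt (fun x => m x + t * p x + t * t * q x) 0 (2 * PI)).
{ rewrite RInt_smooth_plus, RInt_smooth_scal, Elow by assumption; reflexivity. }
rewrite Eup, Elow.
assert (B := fun x => length_first_order (a x) (b x) (u x) (v x) t (P x)).
split; apply RInt_le; [lra | now apply smooth_ex_RInt | exact (Is t) | |
  lra | exact (Is t) | now apply smooth_ex_RInt |]; intros x _; apply B.
Qed.

(* [h' = (e + if) (de + i df)] for [p = (e, f)] and [v = (de, df)]. *)
Definition velocity_prod (p v h : smooth_pair) : Prop := forall x,
  Derive (fst h) x = fst p x * fst v x - snd p x * snd v x /\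
  Derive (snd h) x = fst p x * snd v x + snd p x * fst v x.

Lemma smooth_inner (f g : smooth_fun) : smooth (fun x => f x * g x).
Proof. apply smooth_mult; apply smooth_mapP. Qed.

Lemma velocity_prod_integrals (p v h : smooth_pair) : velocity_prod p v h ->
  fst h (2 * PI) - fst h 0 = inner (fst p) (fst v) - inner (snd p) (snd v) /\
  snd h (2 * PI) - snd h 0 = inner (fst p) (snd v) + inner (snd p) (fst v).
Proof.
intros H; unfold inner; split; rewrite <- RInt_Derive_smooth by apply smooth_mapP.
- rewrite <- RInt_smooth_minus by apply smooth_inner; apply RInt_ext_all; intros x; apply H.
- rewrite <- RInt_smooth_plus by apply smooth_inner; apply RInt_ext_all; intros x; apply H.
Qed.

(** With w = de + i df, the integrand of the first variation is Re (h' conj c') / |c'| = Re (w conj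
    z), because h' = z w and c' = z^2 / 2. *)
Lemma velocity_prod_length (s : parity) (p v h : smooth_pair) : St0 s p -> velocity_prod p v h ->
  is_derive (fun t => curve_length (plus (Phi p) (scal t h))) 0
    (inner (fst p) (fst v) + inner (snd p) (snd v)).
Proof.
intros Hp H; destruct (Phi_based_unit_curves s p Hp) as ((_ & Nc & _) & _).
evar_last; [now apply curve_length_derivative|].
unfold inner; rewrite <- RInt_smooth_plus by apply smooth_inner.
apply RInt_ext_all; intros x; destruct (H x) as [A B].
destruct (Phi_velocity_root p x) as [C D].
rewrite (velocity_root_Cmod p) by apply Phi_velocity_root; rewrite A, B, C, D.
assert (P := sum_sqr_pos _ _ (proj2 Hp x)).
field; lra.
Qed.

Lemma velocity_prod_metric (s : parity) (p v h : smooth_pair) : St0 s p -> velocity_prod p v h ->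
  metric_G (Phi p) h = 2 * metric_St v.
Proof.
intros Hp H; destruct (Phi_based_unit_curves s p Hp) as (_ & _ & L).
unfold metric_G, metric_St, norm_sq, inner; rewrite L, Rinv_1, Rmult_1_l.
transitivity (RInt (fun x => 2 * (fst v x * fst v x + snd v x * snd v x)) 0 (2 * PI)).
2:{ rewrite RInt_smooth_scal by (apply smooth_plus; apply smooth_inner).
    now rewrite RInt_smooth_plus by apply smooth_inner. }
apply RInt_ext_all; intros x; destruct (H x) as [A B].
assert (P := sum_sqr_pos _ _ (proj2 Hp x)).
set (rho := fst p x * fst p x + snd p x * snd p x) in P.
unfold Ds; rewrite Cmod_mult, Cmod_R, (velocity_root_Cmod p) by apply Phi_velocity_root.
fold rho; rewrite Rabs_pos_eq by (left; apply Rinv_0_lt_compat; lra).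
rewrite Rpow_mult_distr; unfold C_deriv; rewrite Cmod_pair.
replace (sqrt (Derive (fst h) x * Derive (fst h) x + Derive (snd h) x * Derive (snd h) x) ^ 2)
  with (rho * (fst v x * fst v x + snd v x * snd v x)).
{ field; lra. }
simpl; rewrite Rmult_1_r, sqrt_sqrt by apply sum_sqr_nonneg; rewrite A, B; unfold rho; ring.
Qed.

Definition sf_minus (f g : smooth_fun) : smooth_fun := smooth_fun_plus f (smooth_fun_scal (-1) g).

Definition dPhi (p v : smooth_pair) : smooth_pair :=
  (sf_RInt (sf_minus (sf_mult (fst p) (fst v)) (sf_mult (snd p) (snd v))),
   sf_RInt (smooth_fun_plus (sf_mult (fst p) (snd v)) (sf_mult (snd p) (fst v)))).

Lemma Derive_sf_RInt (f : smooth_fun) (x : R) : Derive (sf_RInt f) x = f x.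
Proof. apply (Derive_smooth_RInt f), smooth_mapP. Qed.

Lemma sf_RInt_0 (f : smooth_fun) : sf_RInt f 0 = 0.
Proof. apply (RInt_point (V := R_CompleteNormedModule)). Qed.

Lemma dPhi_velocity_prod (p v : smooth_pair) : velocity_prod p v (dPhi p v).
Proof.
intros x; unfold dPhi; cbn [fst snd]; rewrite !Derive_sf_RInt; split; simpl; ring.
Qed.

Lemma velocity_prod_dPhi (p v h : smooth_pair) : velocity_prod p v h -> to_C h 0 = 0%C -> h = dPhi p v.
Proof.
intros H E; injection E as E1 E2.
rewrite (surjective_pairing h); apply (f_equal2 pair); apply smooth_fun_eq_Derive.
- now rewrite sf_RInt_0.
- intros x; rewrite Derive_sf_RInt, (proj1 (H x)); simpl; ring.
- now rewrite sf_RInt_0.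
- intros x; rewrite Derive_sf_RInt, (proj2 (H x)); simpl; ring.
Qed.

(** * Directional derivatives of [Phi] *)

Definition half_sqr_re (p : smooth_pair) : smooth_fun :=
  smooth_fun_scal (/ 2) (sf_minus (sf_mult (fst p) (fst p)) (sf_mult (snd p) (snd p))).

(** This writes [Phi] with the operations for which limits, velocities and path expressions have
    rules. *)
Lemma Phi_sf_RInt (p : smooth_pair) :
  Phi p = (sf_RInt (half_sqr_re p), sf_RInt (sf_mult (fst p) (snd p))).
Proof.
apply velocity_root_Phi; [|unfold to_C; cbn [fst snd]; now rewrite !sf_RInt_0].
intros x; cbn [fst snd]; rewrite !Derive_sf_RInt; split; simpl; ring.
Qed.

Lemma velocity_line (f g : smooth_fun) (t : R) : is_velocity (fun t : R => plus f (scal t g)) t g.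
Proof.
apply is_velocity_cv.
apply cv_all_ext with (4 := cv_all_const (locally' 0) _ (smooth_mapP g)); try typeclasses eauto; auto.
apply locally'_neq; intros h Hh x; unfold quotients.
change (g x = / h * ((f x + (t + h) * g x) - (f x + t * g x))); field; exact Hh.
Qed.

Lemma velocity_scal (a : R) (gamma delta : R -> smooth_fun) (t : R) (v z : smooth_fun) :
  (forall t x, delta t x = a * gamma t x) -> (forall x, z x = a * v x) ->
  is_velocity gamma t v -> is_velocity delta t z.
Proof.
intros Ed Ez Hv.
apply velocity_mult with (fun _ => SmoothFun (smooth_const a)) gamma smooth_fun_zero v; auto.
- intros x; rewrite Ez; simpl; ring.
- now apply velocity_const.
Qed.

Lemma Phi_directional_derivative (p v : smooth_pair) : is_directional_derivative Phi p v (dPhi p v).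
Proof.
set (e := fun t : R => plus (fst p) (scal t (fst v))).
set (f := fun t : R => plus (snd p) (scal t (snd v))).
assert (He : forall t, is_velocity e t (fst v)) by (intros t; apply velocity_line).
assert (Hf : forall t, is_velocity f t (snd v)) by (intros t; apply velocity_line).
assert (E0 : forall x, e 0 x = fst p x) by (intros x; change (fst p x + 0 * fst v x = fst p x); ring).
assert (F0 : forall x, f 0 x = snd p x) by (intros x; change (snd p x + 0 * snd v x = snd p x); ring).
assert (EP : forall t, Phi (plus p (scal t v)) =
  (sf_RInt (half_sqr_re (e t, f t)), sf_RInt (sf_mult (e t) (f t)))) by (intros t; apply Phi_sf_RInt).
apply (is_velocity_pair (E := smooth_fun_NormedModuleAux) (G := smooth_fun_NormedModuleAux)); split.
- apply velocity_RInt with (fun t => half_sqr_re (e t, f t))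
    (sf_minus (sf_mult (fst p) (fst v)) (sf_mult (snd p) (snd v))); try reflexivity.
  { intros t x; now rewrite EP. }
  (* The velocity of e^2 - f^2 is 2 (e de - f df); the factor 1 / 2 of [Phi] cancels the 2. *)
  apply velocity_scal with (/ 2) (fun t => sf_minus (sf_mult (e t) (e t)) (sf_mult (f t) (f t)))
    (smooth_fun_scal 2 (sf_minus (sf_mult (fst p) (fst v)) (sf_mult (snd p) (snd v)))); try reflexivity.
  { intros x; simpl; field. }
  apply velocity_plus with (fun t => sf_mult (e t) (e t)) (fun t => smooth_fun_scal (-1) (sf_mult (f t) (f t)))
    (smooth_fun_scal 2 (sf_mult (fst p) (fst v))) (smooth_fun_scal (-2) (sf_mult (snd p) (snd v)));
    try reflexivity.
  + intros x; simpl; ring.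
  + apply velocity_mult with (3 := He 0) (4 := He 0); [reflexivity|].
    intros x; rewrite E0; simpl; ring.
  + apply velocity_scal with (-1) (fun t => sf_mult (f t) (f t)) (smooth_fun_scal 2 (sf_mult (snd p) (snd v)));
      [reflexivity | intros x; simpl; ring|].
    apply velocity_mult with (3 := Hf 0) (4 := Hf 0); [reflexivity|].
    intros x; rewrite F0; simpl; ring.
- apply velocity_RInt with (fun t => sf_mult (e t) (f t))
    (smooth_fun_plus (sf_mult (fst p) (snd v)) (sf_mult (snd p) (fst v))); try reflexivity.
  { intros t x; now rewrite EP. }
  apply velocity_mult with (3 := He 0) (4 := Hf 0); [reflexivity|].
  intros x; rewrite E0, F0; simpl; ring.
Qed.

Lemma Phi_directional_derivative_unique (p v h : smooth_pair) :
  is_directional_derivative Phi p v h -> h = dPhi p v.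
Proof.
intros H; assert (K := Phi_directional_derivative p v).
apply (is_velocity_pair (E := smooth_fun_NormedModuleAux) (G := smooth_fun_NormedModuleAux)) in H, K.
destruct H as [H1 H2], K as [K1 K2].
rewrite (surjective_pairing h), (surjective_pairing (dPhi p v)); f_equal;
  eapply is_velocity_unique; eassumption.
Qed.

(** The increments of h over a full turn are <e, de> - <f, df> and <e, df> + <f, de>, and the
    derivative of the length is <e, de> + <f, df>. All three vanish exactly when the tangent
    equations of the Stiefel manifold hold. *)
Lemma dPhi_tangent (s : parity) (p v : smooth_pair) : St0 s p -> tangent_St s p v ->
  tangent_based_unit_curves (Phi p) (dPhi p v).
Proof.
intros Hp (Ve & Vf & T1 & T2 & T3).
assert (H := dPhi_velocity_prod p v).
destruct (velocity_prod_integrals _ _ _ H) as [I1 I2].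
destruct (proj1 Hp) as (Pe & Pf & _).
rewrite V_sg in Ve, Vf, Pe, Pf; assert (SS := sg_sqr s).
split; [|split].
- apply periodic_iff; split; apply periodic_of_Derive; try apply smooth_mapP; try lra;
  intros x; [rewrite !(proj1 (H _)) | rewrite !(proj2 (H _))]; rewrite Ve, Vf, Pe, Pf;
  [transitivity ((sg s * sg s) * (fst p x * fst v x - snd p x * snd v x))
  |transitivity ((sg s * sg s) * (fst p x * snd v x + snd p x * fst v x))]; try ring; rewrite SS; ring.
- unfold to_C, dPhi; cbn [fst snd]; now rewrite !sf_RInt_0.
- evar_last; [now apply velocity_prod_length with (v := v) (1 := Hp)|]; lra.
Qed.

Lemma velocity_prod_inv (p v h : smooth_pair) (x : R) : velocity_prod p v h ->
  0 < fst p x * fst p x + snd p x * snd p x ->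
  fst v x = (fst p x * Derive (fst h) x + snd p x * Derive (snd h) x)
            * / (fst p x * fst p x + snd p x * snd p x) /\
  snd v x = (fst p x * Derive (snd h) x - snd p x * Derive (fst h) x)
            * / (fst p x * fst p x + snd p x * snd p x).
Proof. intros H P; destruct (H x) as [A B]; rewrite A, B; split; field; lra. Qed.

Lemma tangent_lift (s : parity) (p h : smooth_pair) : St0 s p ->
  tangent_based_unit_curves (Phi p) h ->
  exists v, tangent_St s p v /\ velocity_prod p v h.
Proof.
intros Hp (Ph & H0 & DL); apply periodic_iff in Ph; destruct Ph as [P1 P2].
assert (P : forall x, 0 < fst p x * fst p x + snd p x * snd p x)
  by (intros x; apply sum_sqr_pos, (proj2 Hp)).
assert (Si : smooth (fun x => / (fst p x * fst p x + snd p x * snd p x))).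
{ apply smooth_inv; [apply smooth_plus; apply smooth_inner | exact P]. }
assert (D1 := smooth_Derive (smooth_mapP (fst h))); assert (D2 := smooth_Derive (smooth_mapP (snd h))).
assert (Se := smooth_mapP (fst p)); assert (Sf := smooth_mapP (snd p)).
(* The quotient h' / z = h' conj z / |z|^2 in real coordinates. *)
set (v := (SmoothFun (smooth_mult (smooth_plus (smooth_mult Se D1) (smooth_mult Sf D2)) Si),
  SmoothFun (smooth_mult (smooth_minus _ _ (smooth_mult Se D2) (smooth_mult Sf D1)) Si))).
assert (H : velocity_prod p v h) by (intros x; specialize (P x); split; simpl; field; lra).
exists v; split; [|exact H].
destruct (velocity_prod_integrals _ _ _ H) as [I1 I2].
assert (L := velocity_prod_length s p v h Hp H).
apply is_derive_unique in L; apply is_derive_unique in DL.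
(* The computed derivative of the length equals the prescribed value 0. Together with the two
   closing equations of h this is a linear system equivalent to the tangent equations. *)
assert (L0 := eq_trans (eq_sym L) DL).
assert (E1 := P1 0); assert (E2 := P2 0); rewrite Rplus_0_l in E1, E2.
destruct Hp as ((Pe & Pf & _) & _); rewrite V_sg in Pe, Pf.
assert (Q1 := smooth_fun_Derive_periodic _ P1).
assert (Q2 := smooth_fun_Derive_periodic _ P2).
assert (Qr : forall x, sg s * fst p x * (sg s * fst p x) + sg s * snd p x * (sg s * snd p x)
  = fst p x * fst p x + snd p x * snd p x).
{ intros x; transitivity ((sg s * sg s) * (fst p x * fst p x + snd p x * snd p x)); [ring|].
  rewrite sg_sqr; ring. }
split; [|split; [|split; [lra|split; lra]]]; rewrite V_sg; intros x; simpl;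
  rewrite Q1, Q2, Pe, Pf, Qr; ring.
Qed.

(** * The covering *)

Lemma periodic_IZR (f : R -> R) (a : R) : (forall x, f (x + a) = f x) ->
  forall (k : Z) (x : R), f (x + IZR k * a) = f x.
Proof.
intros H k; induction k as [|k IH|k IH] using Z.peano_ind; intros x.
- f_equal; ring.
- rewrite <- (IH x), <- (H (x + IZR k * a)); f_equal; rewrite succ_IZR; ring.
- rewrite <- (IH x), <- (H (x + IZR (Z.pred k) * a)); f_equal.
  unfold Z.pred; rewrite plus_IZR; ring.
Qed.

(** Uniform convergence on compact sets controls a function only on bounded intervals, so positivity
    on one compact period is an open condition. Periodicity later extends it to R. *)
Definition pos_on_period (f : R -> R) : Prop := forall x, 0 <= x <= 2 * PI -> 0 < f x.

Lemma pos_on_period_all (f : R -> R) : (forall x, f (x + 2 * PI) = f x) -> pos_on_period f ->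
  forall x, 0 < f x.
Proof.
intros H P x; assert (PP := PI_RGT_0).
(* With w = x / (2 pi), [up] returns an integer u with w < u <= w + 1. Hence w + 1 - u lies in [0,
   1), and the translated point lies in the period. *)
set (k := (1 - up (x / (2 * PI)))%Z).
rewrite <- (periodic_IZR f (2 * PI) H k x); apply P.
destruct (archimed (x / (2 * PI))) as [A B].
unfold k; rewrite minus_IZR.
set (u := IZR (up (x / (2 * PI)))) in *.
assert (E : x = x / (2 * PI) * (2 * PI)) by (field; lra).
set (w := x / (2 * PI)) in *; rewrite E; nra.
Qed.

(** The positive minimum of [L y] over the compact period is the margin within which nearby
    functions stay positive. *)
Lemma open_pos_on_period {U : UniformSpace} (L : U -> R -> R) :
  (forall y, cv_all (locally y) L (L y)) -> open (fun y => pos_on_period (L y)).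
Proof.
intros H y P; assert (PP := PI_RGT_0).
destruct (H y 0%nat) as (_ & S & K).
destruct (continuity_ab_min (L y) 0 (2 * PI)) as (m & Hm & Im); [lra| |].
{ intros c _; apply continuity_pt_filterlim; now apply smooth_continuous. }
generalize (K 0%nat (le_n _) (2 * PI) _ (P m Im)); apply filter_imp; intros z A x Hx.
assert (A' : Rabs (L z x - L y x) < L y m) by (apply A; rewrite Rabs_pos_eq; lra).
specialize (Hm x Hx); apply Rabs_lt_between in A'; lra.
Qed.

Lemma nonvanishing_sign (f : R -> R) : (forall x, continuous f x) -> (forall x, f x <> 0) ->
  (forall x, 0 < f x) \/ (forall x, f x < 0).
Proof.
intros C N.
assert (C' : continuity f) by (intros x; apply continuity_pt_filterlim, C).
assert (L : forall x y, x < y -> f x < 0 -> 0 < f y -> False).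
{ intros x y H A B; destruct (IVT f x y C' H A B) as (z & _ & E); exact (N z E). }
assert (L' : forall x y, x < y -> 0 < f x -> f y < 0 -> False).
{ intros x y H A B; destruct (IVT (fun x => - f x) x y) as (z & _ & E); try lra.
  - now apply continuity_opp.
  - apply (N z); lra. }
destruct (Rtotal_order (f 0) 0) as [A|[A|A]]; [right | now destruct (N 0) | left]; intros x;
  destruct (Rtotal_order (f x) 0) as [B|[B|B]]; auto; try (now destruct (N x)); exfalso;
  (destruct (Rtotal_order x 0) as [D|[D|D]]; [| subst; lra |]); eauto.
Qed.

(** * Continuity and smoothness of [Phi] *)

Section Continuity.

Context {T : Type} (F : (T -> Prop) -> Prop) {FF : Filter F}.

Lemma cv_all_pair (u : T -> smooth_pair) (p : smooth_pair) : filterlim u F (locally p) <->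
  cv_all F (fun t => fst (u t)) (fst p) /\ cv_all F (fun t => snd (u t)) (snd p).
Proof.
rewrite (filterlim_pair_iff F u p); split; intros [A B]; split;
  try (now apply filterlim_cv_all); now apply cv_all_filterlim.
Qed.

Lemma cv_all_minus (u v : T -> R -> R) (f g : R -> R) :
  cv_all F u f -> cv_all F v g -> cv_all F (fun t x => u t x - v t x) (fun x => f x - g x).
Proof.
intros A B; apply cv_all_ext with (4 := cv_all_plus F _ _ _ _ A (cv_all_scal F (-1) _ _ B)); auto.
- apply filter_forall; intros t x; ring.
- intros x; ring.
Qed.

Lemma filterlim_Phi (u : T -> smooth_pair) (p : smooth_pair) : filterlim u F (locally p) ->
  filterlim (fun t => Phi (u t)) F (locally (Phi p)).
Proof.
rewrite !cv_all_pair; intros [A B]; split.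
- apply cv_all_ext with (4 := cv_all_RInt F _ _ (cv_all_scal F (/ 2) _ _
    (cv_all_minus _ _ _ _ (cv_all_mult F _ _ _ _ A A) (cv_all_mult F _ _ _ _ B B)))); auto.
  + apply filter_forall; intros t x; rewrite Phi_sf_RInt; simpl; apply RInt_ext_all; intros; ring.
  + intros x; rewrite Phi_sf_RInt; simpl; apply RInt_ext_all; intros; ring.
- apply cv_all_ext with (4 := cv_all_RInt F _ _ (cv_all_mult F _ _ _ _ A B)); auto.
  + apply filter_forall; intros t x; now rewrite Phi_sf_RInt.
  + intros x; now rewrite Phi_sf_RInt.
Qed.

End Continuity.

Lemma Phi_continuous_on (A : smooth_pair -> Prop) : continuous_on A Phi.
Proof.
intros p _; apply (filterlim_Phi (within A (locally p)) (fun q => q)).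
apply filter_le_within.
Qed.

Lemma Phi_smooth_on (A : smooth_pair -> Prop) : smooth_on A Phi.
Proof.
intros gamma Hg _.
apply (smooth_path_pair (E := smooth_fun_NormedModuleAux) (G := smooth_fun_NormedModuleAux)) in Hg.
destruct Hg as [He Hf]; apply smooth_path_fn in He, Hf.
apply (smooth_path_pair (E := smooth_fun_NormedModuleAux) (G := smooth_fun_NormedModuleAux)).
split; apply path_fn_smooth.
- apply path_fn_ext with (2 := path_fn_RInt _ (path_fn_scal (/ 2) _
    (path_fn_minus _ _ (path_fn_mult _ _ He He) (path_fn_mult _ _ Hf Hf)))).
  intros t x; rewrite Phi_sf_RInt; simpl; apply RInt_ext_all; intros; ring.
- apply path_fn_ext with (2 := path_fn_RInt _ (path_fn_mult _ _ He Hf)).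
  intros t x; now rewrite Phi_sf_RInt.
Qed.

(** * Explicit local sections of [Phi] *)

Definition to_smooth (f : R -> R) : smooth_fun :=
  match excluded_middle_informative (smooth f) with
  | left H => SmoothFun H
  | right _ => smooth_fun_zero
  end.

Lemma to_smoothE (f : R -> R) (x : R) : smooth f -> to_smooth f x = f x.
Proof. intros H; unfold to_smooth; now destruct (excluded_middle_informative (smooth f)). Qed.

(* [dot c y + i cross c y = y' * conj c']. *)
Definition dot (c y : smooth_pair) (x : R) : R :=
  Derive (fst y) x * Derive (fst c) x + Derive (snd y) x * Derive (snd c) x.
Definition cross (c y : smooth_pair) (x : R) : R :=
  Derive (snd y) x * Derive (fst c) x - Derive (fst y) x * Derive (snd c) x.
Definition dot_norm (c y : smooth_pair) (x : R) : R :=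
  sqrt (dot c y x * dot c y x + cross c y x * cross c y x).

(* The real and imaginary parts of the principal square root of [y' * conj c']. *)
Definition root_re (c y : smooth_pair) (x : R) : R := sqrt (/ 2 * (dot_norm c y x + dot c y x)).
Definition root_im (c y : smooth_pair) (x : R) : R := / 2 * (cross c y x * / root_re c y x).

(* The lift of [y] close to the lift [z0 = p] of [c] is
   [2 sqrt (y' conj c') / conj z0], because [conj z0 ^ 2 = 2 conj c']. *)
Definition lift_re (p c y : smooth_pair) (x : R) : R :=
  2 * (root_re c y x * fst p x - root_im c y x * snd p x) * / (fst p x * fst p x + snd p x * snd p x).
Definition lift_im (p c y : smooth_pair) (x : R) : R :=
  2 * (root_re c y x * snd p x + root_im c y x * fst p x) * / (fst p x * fst p x + snd p x * snd p x).

Definition sheet_sign (i : nat) : R := match i with 0%nat => 1 | _ => -1 end.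

(** A section has to be total on pairs, while the lift formula is shown to be smooth only where
    [dot c y] is positive. [to_smooth] supplies the zero function when smoothness fails. *)
Definition local_section (p c : smooth_pair) (i : nat) (y : smooth_pair) : smooth_pair :=
  (to_smooth (fun x => sheet_sign i * lift_re p c y x),
   to_smooth (fun x => sheet_sign i * lift_im p c y x)).

(* [pair_dot z0 z = Re (z * conj z0)]. *)
Definition pair_dot (p q : smooth_pair) (x : R) : R := fst q x * fst p x + snd q x * snd p x.

Lemma sheet_sign_sqr (i : nat) : sheet_sign i * sheet_sign i = 1.
Proof. destruct i; simpl; ring. Qed.

Section LocalSection.

Variables p c : smooth_pair.
Hypothesis root_pc : velocity_root p c.
Hypothesis nonzero_p : forall x, ~ (fst p x = 0 /\ snd p x = 0).

Let rho (x : R) : R := fst p x * fst p x + snd p x * snd p x.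

Let rho_pos (x : R) : 0 < rho x.
Proof. apply sum_sqr_pos, nonzero_p. Qed.

Let smooth_rho : smooth rho.
Proof. apply smooth_plus; apply smooth_inner. Qed.

Let smooth_inv_rho : smooth (fun x => / rho x).
Proof. exact (smooth_inv _ smooth_rho rho_pos). Qed.

Let smooth_dc1 : smooth (Derive (fst c)).
Proof. apply smooth_Derive, smooth_mapP. Qed.

Let smooth_dc2 : smooth (Derive (snd c)).
Proof. apply smooth_Derive, smooth_mapP. Qed.

Lemma smooth_dot (y : smooth_pair) : smooth (dot c y).
Proof. apply smooth_plus; apply smooth_mult; auto; apply smooth_Derive, smooth_mapP. Qed.

Lemma smooth_cross (y : smooth_pair) : smooth (cross c y).
Proof. apply smooth_minus; apply smooth_mult; auto; apply smooth_Derive, smooth_mapP. Qed.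

Section Positive.

Variable y : smooth_pair.
Hypothesis dot_pos : forall x, 0 < dot c y x.

Lemma dot_sqr_pos (x : R) : 0 < dot c y x * dot c y x + cross c y x * cross c y x.
Proof. assert (h := dot_pos x); assert (h2 := Rle_0_sqr (cross c y x)); unfold Rsqr in h2; nra. Qed.

Lemma dot_norm_pos (x : R) : 0 < dot_norm c y x.
Proof. apply sqrt_lt_R0, dot_sqr_pos. Qed.

Lemma root_arg_pos (x : R) : 0 < / 2 * (dot_norm c y x + dot c y x).
Proof. assert (h := dot_pos x); assert (h2 := dot_norm_pos x); lra. Qed.

Lemma root_re_pos (x : R) : 0 < root_re c y x.
Proof. apply sqrt_lt_R0, root_arg_pos. Qed.

Lemma smooth_dot_norm : smooth (dot_norm c y).
Proof.
apply smooth_sqrt; [|apply dot_sqr_pos].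
exact (smooth_plus (smooth_mult (smooth_dot y) (smooth_dot y)) (smooth_mult (smooth_cross y) (smooth_cross y))).
Qed.

Lemma smooth_root_re : smooth (root_re c y).
Proof.
apply smooth_sqrt; [|apply root_arg_pos].
apply smooth_scal, smooth_plus; [apply smooth_dot_norm | apply smooth_dot].
Qed.

Lemma smooth_root_im : smooth (root_im c y).
Proof.
apply smooth_scal, smooth_mult; [apply smooth_cross|].
apply smooth_inv; [apply smooth_root_re | apply root_re_pos].
Qed.

Lemma smooth_lift_re : smooth (lift_re p c y).
Proof.
apply smooth_mult; [|exact smooth_inv_rho].
exact (smooth_scal 2 (smooth_minus _ _ (smooth_mult smooth_root_re (smooth_mapP (fst p)))
  (smooth_mult smooth_root_im (smooth_mapP (snd p))))).
Qed.

Lemma smooth_lift_im : smooth (lift_im p c y).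
Proof.
apply smooth_mult; [|exact smooth_inv_rho].
exact (smooth_scal 2 (smooth_plus (smooth_mult smooth_root_re (smooth_mapP (snd p)))
  (smooth_mult smooth_root_im (smooth_mapP (fst p))))).
Qed.

Lemma local_section_fst (i : nat) (x : R) :
  fst (local_section p c i y) x = sheet_sign i * lift_re p c y x.
Proof. apply (to_smoothE (fun x => sheet_sign i * lift_re p c y x)), smooth_scal, smooth_lift_re. Qed.

Lemma local_section_snd (i : nat) (x : R) :
  snd (local_section p c i y) x = sheet_sign i * lift_im p c y x.
Proof. apply (to_smoothE (fun x => sheet_sign i * lift_im p c y x)), smooth_scal, smooth_lift_im. Qed.

(** For a number D + i X of modulus N, the real part u of the root satisfies u^2 = (N + D) / 2, and
    X^2 = (N - D)(N + D) gives v^2 = (N - D) / 2 for v = X / (2 u). Positivity of D makes u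
    nonzero. *)
Lemma root_sqr (x : R) :
  root_re c y x * root_re c y x - root_im c y x * root_im c y x = dot c y x /\
  2 * (root_re c y x * root_im c y x) = cross c y x.
Proof.
assert (P := root_re_pos x).
assert (E : root_re c y x * root_re c y x = / 2 * (dot_norm c y x + dot c y x))
  by (apply sqrt_sqrt; left; apply root_arg_pos).
assert (N : dot_norm c y x * dot_norm c y x = dot c y x * dot c y x + cross c y x * cross c y x)
  by (apply sqrt_sqrt; left; apply dot_sqr_pos).
assert (D := dot_pos x); assert (DN := dot_norm_pos x).
split; [|unfold root_im; field; lra].
unfold root_im; apply Rmult_eq_reg_l with (root_re c y x * root_re c y x); [|nra].
transitivity ((root_re c y x * root_re c y x) * (root_re c y x * root_re c y x)
  - / 4 * (cross c y x * cross c y x)); [field; lra|].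
replace (cross c y x * cross c y x) with (dot_norm c y x * dot_norm c y x - dot c y x * dot c y x) by lra.
rewrite E; field.
Qed.

Lemma local_section_root (i : nat) : velocity_root (local_section p c i y) y.
Proof.
intros x; rewrite local_section_fst, local_section_snd.
destruct (root_sqr x) as [A B]; destruct (root_pc x) as [C D].
assert (P := rho_pos x); assert (SS := sheet_sign_sqr i).
unfold lift_re, lift_im; fold (rho x).
set (u := root_re c y x) in *; set (v := root_im c y x) in *.
set (e := fst p x) in *; set (f := snd p x) in *; set (k := sheet_sign i) in *.
set (y1 := Derive (fst y) x); set (y2 := Derive (snd y) x).
assert (A' : u * u - v * v = y1 * (/ 2 * (e * e - f * f)) + y2 * (e * f))
  by (rewrite A; unfold dot; now rewrite C, D).
assert (B' : 2 * (u * v) = y2 * (/ 2 * (e * e - f * f)) - y1 * (e * f))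
  by (rewrite B; unfold cross; now rewrite C, D).
assert (R : rho x = e * e + f * f) by reflexivity.
(* Half the square of the lift is 2 k^2 (u + iv)^2 z0^2 / |z0|^4. The intermediate terms are its
   real and imaginary parts, grouped so that k^2 and (u + iv)^2 can be substituted. *)
split.
- transitivity (2 * (k * k) * ((u * u - v * v) * (e * e - f * f) - (2 * (u * v)) * (2 * (e * f)))
    * / (rho x * rho x)).
  + rewrite SS, A', B', R; field; lra.
  + field; lra.
- transitivity (2 * (k * k) * ((2 * (u * v)) * (e * e - f * f) + (u * u - v * v) * (2 * (e * f)))
    * / (rho x * rho x)).
  + rewrite SS, A', B', R; field; lra.
  + field; lra.
Qed.

(** The lift times conj z0 is 2 k (u + iv) with k = [sheet_sign i], and the principal root has u >
    0. *)
Lemma local_section_sign (i : nat) (x : R) : 0 < sheet_sign i * pair_dot p (local_section p c i y) x.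
Proof.
unfold pair_dot; rewrite local_section_fst, local_section_snd.
assert (P := rho_pos x); assert (SS := sheet_sign_sqr i).
replace (sheet_sign i * _) with ((sheet_sign i * sheet_sign i) * (2 * root_re c y x)).
- rewrite SS; assert (Q := root_re_pos x); lra.
- unfold lift_re, lift_im; fold (rho x); unfold rho in P |- *; field; lra.
Qed.

Lemma root_eq (a b x : R) : 0 < a ->
  dot c y x = a * a - b * b -> cross c y x = 2 * (a * b) ->
  root_re c y x = a /\ root_im c y x = b.
Proof.
intros Pa D X.
assert (N : dot_norm c y x = a * a + b * b).
{ apply sqrt_lem_1; [left; apply dot_sqr_pos | nra | rewrite D, X; ring]. }
assert (E : root_re c y x = a).
{ apply sqrt_lem_1; [left; apply root_arg_pos | lra | rewrite N, D; field]. }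
split; [exact E|]; unfold root_im; rewrite E, X; field; lra.
Qed.

(** For any lift z of y, the number k z conj z0 / 2 with k = [sheet_sign i] squares to y' conj c'.
    The sign hypothesis makes its real part positive, so it is the principal root, and z is
    recovered by dividing by conj z0. *)
Lemma local_section_unique (i : nat) (q : smooth_pair) : velocity_root q y ->
  (forall x, 0 < sheet_sign i * pair_dot p q x) -> local_section p c i y = q.
Proof.
intros Hq Sq.
assert (SS := sheet_sign_sqr i).
assert (K : forall x, root_re c y x = / 2 * (sheet_sign i * pair_dot p q x) /\
  root_im c y x = / 2 * (sheet_sign i * (snd q x * fst p x - fst q x * snd p x))).
{ intros x; destruct (Hq x) as [A B]; destruct (root_pc x) as [C D].
  apply root_eq; [specialize (Sq x); lra | |].
  - transitivity (/ 4 * (sheet_sign i * sheet_sign i) * (pair_dot p q x * pair_dot p q x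
      - (snd q x * fst p x - fst q x * snd p x) * (snd q x * fst p x - fst q x * snd p x))); [|field].
    rewrite SS; unfold dot, pair_dot; rewrite A, B, C, D; field.
  - transitivity (/ 2 * (sheet_sign i * sheet_sign i) * (pair_dot p q x
      * (snd q x * fst p x - fst q x * snd p x))); [|field].
    rewrite SS; unfold cross, pair_dot; rewrite A, B, C, D; field. }
rewrite (surjective_pairing q), (surjective_pairing (local_section p c i y)).
apply (f_equal2 pair); apply smooth_fun_eq; intros x; destruct (K x) as [E1 E2];
  assert (P := rho_pos x); unfold rho in P.
- rewrite local_section_fst; unfold lift_re; rewrite E1, E2; unfold pair_dot.
  transitivity ((sheet_sign i * sheet_sign i) * fst q x); [field; lra | rewrite SS; ring].
- rewrite local_section_snd; unfold lift_im; rewrite E1, E2; unfold pair_dot.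
  transitivity ((sheet_sign i * sheet_sign i) * snd q x); [field; lra | rewrite SS; ring].
Qed.

(** The root of y' conj c' is periodic, and z0 / |z0|^2 has multiplier [sg s], so the lift inherits
    the parity of z0. *)
Lemma local_section_V (s : parity) (i : nat) : V s (fst p) -> V s (snd p) -> periodic c -> periodic y ->
  V s (fst (local_section p c i y)) /\ V s (snd (local_section p c i y)).
Proof.
rewrite !V_sg, !periodic_iff; intros Ve Vf [C1 C2] [Y1 Y2].
assert (D : forall x, dot c y (x + 2 * PI) = dot c y x)
  by (intros x; unfold dot; now rewrite !smooth_fun_Derive_periodic).
assert (X : forall x, cross c y (x + 2 * PI) = cross c y x)
  by (intros x; unfold cross; now rewrite !smooth_fun_Derive_periodic).
assert (U : forall x, root_re c y (x + 2 * PI) = root_re c y x)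
  by (intros x; unfold root_re, dot_norm; now rewrite D, X).
assert (W : forall x, root_im c y (x + 2 * PI) = root_im c y x)
  by (intros x; unfold root_im; now rewrite U, X).
assert (Q : forall x, sg s * fst p x * (sg s * fst p x) + sg s * snd p x * (sg s * snd p x) = rho x).
{ intros x; transitivity ((sg s * sg s) * rho x); [unfold rho; ring|]; rewrite sg_sqr; ring. }
split; intros x; rewrite ?local_section_fst, ?local_section_snd; unfold lift_re, lift_im;
  rewrite U, W, Ve, Vf, Q; fold (rho x); ring.
Qed.

End Positive.

(** * Continuity and smoothness of the local sections *)

Section SectionContinuity.

Context {T : Type} (F : (T -> Prop) -> Prop) {FF : Filter F}.
Variables (u : T -> smooth_pair) (l : smooth_pair).
Hypothesis lim_u : filterlim u F (locally l).

Lemma cv_dot : cv_all F (fun t => dot c (u t)) (dot c l).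
Proof.
apply cv_all_pair in lim_u; [|exact FF]; destruct lim_u as [A B].
exact (cv_all_plus F _ _ _ _
  (cv_all_mult F _ _ _ _ (cv_all_Derive F _ _ A) (cv_all_const F _ smooth_dc1))
  (cv_all_mult F _ _ _ _ (cv_all_Derive F _ _ B) (cv_all_const F _ smooth_dc2))).
Qed.

Lemma cv_cross : cv_all F (fun t => cross c (u t)) (cross c l).
Proof.
apply cv_all_pair in lim_u; [|exact FF]; destruct lim_u as [A B].
exact (cv_all_minus F _ _ _ _
  (cv_all_mult F _ _ _ _ (cv_all_Derive F _ _ B) (cv_all_const F _ smooth_dc1))
  (cv_all_mult F _ _ _ _ (cv_all_Derive F _ _ A) (cv_all_const F _ smooth_dc2))).
Qed.

Lemma cv_pair_dot (k : R) : cv_all F (fun t x => k * pair_dot p (u t) x) (fun x => k * pair_dot p l x).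
Proof.
apply cv_all_pair in lim_u; [|exact FF]; destruct lim_u as [A B].
exact (cv_all_scal F k _ _ (cv_all_plus F _ _ _ _
  (cv_all_mult F _ _ _ _ A (cv_all_const F _ (smooth_mapP (fst p))))
  (cv_all_mult F _ _ _ _ B (cv_all_const F _ (smooth_mapP (snd p)))))).
Qed.

Hypothesis pos_u : F (fun t => forall x, 0 < dot c (u t) x).
Hypothesis pos_l : forall x, 0 < dot c l x.

Lemma filterlim_local_section (i : nat) :
  filterlim (fun t => local_section p c i (u t)) F (locally (local_section p c i l)).
Proof.
assert (N : cv_all F (fun t => dot_norm c (u t)) (dot_norm c l)).
{ apply (cv_all_sqrt F (fun t x => dot c (u t) x * dot c (u t) x + cross c (u t) x * cross c (u t) x)).
  - revert pos_u; apply filter_imp; intros t; apply dot_sqr_pos.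
  - now apply dot_sqr_pos.
  - exact (cv_all_plus F _ _ _ _ (cv_all_mult F _ _ _ _ cv_dot cv_dot) (cv_all_mult F _ _ _ _ cv_cross cv_cross)). }
assert (U : cv_all F (fun t => root_re c (u t)) (root_re c l)).
{ apply (cv_all_sqrt F (fun t x => / 2 * (dot_norm c (u t) x + dot c (u t) x))).
  - revert pos_u; apply filter_imp; intros t; apply root_arg_pos.
  - now apply root_arg_pos.
  - exact (cv_all_scal F (/ 2) _ _ (cv_all_plus F _ _ _ _ N cv_dot)). }
assert (W : cv_all F (fun t => root_im c (u t)) (root_im c l)).
{ assert (P : F (fun t => forall x, 0 < root_re c (u t) x))
    by (revert pos_u; apply filter_imp; intros t; apply root_re_pos).
  exact (cv_all_scal F (/ 2) _ _ (cv_all_mult F _ _ _ _ cv_cross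
    (cv_all_inv F _ _ P (root_re_pos l pos_l) U))). }
assert (Ce := cv_all_const F _ (smooth_mapP (fst p))).
assert (Cf := cv_all_const F _ (smooth_mapP (snd p))).
assert (Ci := cv_all_const F _ smooth_inv_rho).
apply cv_all_pair; [exact FF|]; split.
- apply cv_all_ext with (u := fun t x => sheet_sign i * lift_re p c (u t) x)
    (f := fun x => sheet_sign i * lift_re p c l x); auto.
  + revert pos_u; apply filter_imp; intros t P x; now rewrite local_section_fst.
  + intros x; now rewrite local_section_fst.
  + exact (cv_all_scal F _ _ _ (cv_all_mult F _ _ _ _ (cv_all_scal F 2 _ _ (cv_all_minus F _ _ _ _
      (cv_all_mult F _ _ _ _ U Ce) (cv_all_mult F _ _ _ _ W Cf))) Ci)).
- apply cv_all_ext with (u := fun t x => sheet_sign i * lift_im p c (u t) x)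
    (f := fun x => sheet_sign i * lift_im p c l x); auto.
  + revert pos_u; apply filter_imp; intros t P x; now rewrite local_section_snd.
  + intros x; now rewrite local_section_snd.
  + exact (cv_all_scal F _ _ _ (cv_all_mult F _ _ _ _ (cv_all_scal F 2 _ _ (cv_all_plus F _ _ _ _
      (cv_all_mult F _ _ _ _ U Cf) (cv_all_mult F _ _ _ _ W Ce))) Ci)).
Qed.

End SectionContinuity.

End LocalSection.

Lemma local_section_smooth_on (p c : smooth_pair) (U : smooth_pair -> Prop) (i : nat) :
  (forall x, ~ (fst p x = 0 /\ snd p x = 0)) -> (forall y, U y -> forall x, 0 < dot c y x) ->
  smooth_on U (local_section p c i).
Proof.
intros NZ PU gamma Hg UG.
assert (PG : forall t x, 0 < dot c (gamma t) x) by (intros t; apply PU, UG).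
apply (smooth_path_pair (E := smooth_fun_NormedModuleAux) (G := smooth_fun_NormedModuleAux)) in Hg.
destruct Hg as [H1 H2]; apply smooth_path_fn, path_fn_Derive in H1, H2.
assert (C1 := path_fn_const _ (smooth_Derive (smooth_mapP (fst c)))).
assert (C2 := path_fn_const _ (smooth_Derive (smooth_mapP (snd c)))).
assert (Ce := path_fn_const _ (smooth_mapP (fst p))).
assert (Cf := path_fn_const _ (smooth_mapP (snd p))).
assert (Ci : path_fn (fun _ x => / (fst p x * fst p x + snd p x * snd p x))).
{ apply (path_fn_inv (fun _ x => fst p x * fst p x + snd p x * snd p x)).
  - intros _ x; apply sum_sqr_pos, NZ.
  - exact (path_fn_plus _ _ (path_fn_mult _ _ Ce Ce) (path_fn_mult _ _ Cf Cf)). }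
assert (D : path_fn (fun t => dot c (gamma t)))
  by exact (path_fn_plus _ _ (path_fn_mult _ _ H1 C1) (path_fn_mult _ _ H2 C2)).
assert (X : path_fn (fun t => cross c (gamma t)))
  by exact (path_fn_minus _ _ (path_fn_mult _ _ H2 C1) (path_fn_mult _ _ H1 C2)).
assert (N : path_fn (fun t => dot_norm c (gamma t)))
  by exact (path_fn_sqrt _ (fun t => dot_sqr_pos c (gamma t) (PG t))
    (path_fn_plus _ _ (path_fn_mult _ _ D D) (path_fn_mult _ _ X X))).
assert (A : path_fn (fun t => root_re c (gamma t)))
  by exact (path_fn_sqrt _ (fun t => root_arg_pos c (gamma t) (PG t))
    (path_fn_scal (/ 2) _ (path_fn_plus _ _ N D))).
assert (B : path_fn (fun t => root_im c (gamma t)))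
  by exact (path_fn_scal (/ 2) _ (path_fn_mult _ _ X
    (path_fn_inv _ (fun t => root_re_pos c (gamma t) (PG t)) A))).
apply (smooth_path_pair (E := smooth_fun_NormedModuleAux) (G := smooth_fun_NormedModuleAux)).
split; apply path_fn_smooth.
- apply path_fn_ext with (u := fun t x => sheet_sign i * lift_re p c (gamma t) x).
  + intros t x; now rewrite local_section_fst.
  + exact (path_fn_scal _ _ (path_fn_mult _ _ (path_fn_scal 2 _
      (path_fn_minus _ _ (path_fn_mult _ _ A Ce) (path_fn_mult _ _ B Cf))) Ci)).
- apply path_fn_ext with (u := fun t x => sheet_sign i * lift_im p c (gamma t) x).
  + intros t x; now rewrite local_section_snd.
  + exact (path_fn_scal _ _ (path_fn_mult _ _ (path_fn_scal 2 _
      (path_fn_plus _ _ (path_fn_mult _ _ A Cf) (path_fn_mult _ _ B Ce))) Ci)).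
Qed.

(* [(z conj z0)^2 = 4 y' conj c'], and the square of an imaginary number is not positive. *)
Lemma pair_dot_nonzero (p c q y : smooth_pair) (x : R) : velocity_root p c -> velocity_root q y ->
  0 < dot c y x -> pair_dot p q x <> 0.
Proof.
intros Hp Hq D E; destruct (Hp x) as [A B]; destruct (Hq x) as [A' B'].
set (w := snd q x * fst p x - fst q x * snd p x).
assert (K : 4 * dot c y x = pair_dot p q x * pair_dot p q x - w * w)
  by (unfold w, dot, pair_dot; rewrite A, B, A', B'; field).
assert (W := Rle_0_sqr w); unfold Rsqr in W; rewrite E in K; lra.
Qed.

(** * Open sheets and the evenly covered neighbourhoods *)

Lemma dot_periodic (c y : smooth_pair) : periodic c -> periodic y ->
  forall x, dot c y (x + 2 * PI) = dot c y x.
Proof.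
rewrite !periodic_iff; intros [C1 C2] [Y1 Y2] x; unfold dot; now rewrite !smooth_fun_Derive_periodic.
Qed.

Lemma pair_dot_periodic (s : parity) (p q : smooth_pair) : St0 s p -> St0 s q ->
  forall x, pair_dot p q (x + 2 * PI) = pair_dot p q x.
Proof.
intros ((Pe & Pf & _) & _) ((Qe & Qf & _) & _) x; rewrite V_sg in Pe, Pf, Qe, Qf.
unfold pair_dot; rewrite Pe, Pf, Qe, Qf.
transitivity ((sg s * sg s) * (fst q x * fst p x + snd q x * snd p x)); [ring|].
rewrite sg_sqr; ring.
Qed.

Lemma smooth_pair_dot (p q : smooth_pair) : smooth (pair_dot p q).
Proof. apply smooth_plus; apply smooth_inner. Qed.

Lemma open_dot_pos (c : smooth_pair) : open (fun y : smooth_pair => pos_on_period (dot c y)).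
Proof.
apply (open_pos_on_period (fun y : smooth_pair => dot c y)); intros y.
exact (cv_dot c (locally y) (fun y => y) y (fun P H => H)).
Qed.

Lemma open_sheet (p c : smooth_pair) (k : R) :
  open (fun q : smooth_pair => pos_on_period (dot c (Phi q)) /\
    pos_on_period (fun x => k * pair_dot p q x)).
Proof.
apply open_and.
- apply (open_pos_on_period (fun q : smooth_pair => dot c (Phi q))); intros q.
  exact (cv_dot c (locally q) Phi (Phi q) (filterlim_Phi (locally q) (fun q => q) q (fun P H => H))).
- apply (open_pos_on_period (fun (q : smooth_pair) x => k * pair_dot p q x)); intros q.
  exact (cv_pair_dot p (locally q) (fun q => q) q (fun P H => H) k).
Qed.

Lemma local_section_continuous_on (p c : smooth_pair) (U : smooth_pair -> Prop) (i : nat) :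
  (forall x, ~ (fst p x = 0 /\ snd p x = 0)) -> (forall y, U y -> forall x, 0 < dot c y x) ->
  continuous_on U (local_section p c i).
Proof.
intros NZ PU y Uy; apply (filterlim_local_section p c NZ (within U (locally y)) (fun y => y)).
- apply filter_le_within.
- unfold within; apply filter_forall; exact PU.
- now apply PU.
Qed.

Lemma Phi_smooth_covering (s : parity) : smooth_covering 2 (St0 s) (based_unit_curves s) Phi.
Proof.
split; [apply Phi_based_unit_curves|]; split; [apply Phi_continuous_on|].
split; [apply Phi_smooth_on|]; intros c Hc.
destruct (exists_velocity_root s c (proj1 Hc)) as (p & Rp & Ve & Vf).
assert (Sp := velocity_root_St0 s p c Rp Hc Ve Vf).
assert (NZ := proj2 Sp).
assert (Pc := proj1 (proj1 Hc)).
set (U := fun y => based_unit_curves s y /\ pos_on_period (dot c y)).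
assert (PU : forall y, U y -> forall x, 0 < dot c y x).
{ intros y [By Py]; apply pos_on_period_all; [|exact Py].
  apply dot_periodic; [exact Pc | apply By]. }
exists U; split; [|split].
{ exists (fun y => pos_on_period (dot c y)); split; [|reflexivity].
  exact (open_dot_pos c). }
{ split; [exact Hc|]; intros x _; apply C_deriv_nonzero, Hc. }
exists (fun i q => St0 s q /\ U (Phi q) /\ pos_on_period (fun x => sheet_sign i * pair_dot p q x)),
  (local_section p c).
assert (sign_all : forall i q, St0 s q -> pos_on_period (fun x => sheet_sign i * pair_dot p q x) ->
  forall x, 0 < sheet_sign i * pair_dot p q x).
{ intros i q Sq; apply (pos_on_period_all (fun x => sheet_sign i * pair_dot p q x)); intros x.
  now rewrite (pair_dot_periodic s). }
split; [|split].
- intros q; split.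
  + intros [Sq Uq].
    (* On the preimage of [U] the function Re (z conj z0) never vanishes, so it has a constant sign,
       which selects the sheet. *)
    destruct (nonvanishing_sign (pair_dot p q)) as [P|P].
    * intros x; apply smooth_continuous, smooth_pair_dot.
    * intros x; now apply (pair_dot_nonzero p c q (Phi q) x Rp (Phi_velocity_root q)), PU.
    * exists 0%nat; split; [lia|]; split; [exact Sq|]; split; [exact Uq|].
      intros x _; simpl; rewrite Rmult_1_l; apply P.
    * exists 1%nat; split; [lia|]; split; [exact Sq|]; split; [exact Uq|].
      intros x _; simpl; specialize (P x); lra.
  + intros (i & _ & Sq & Uq & _); now split.
- intros i j q Hi Hj (_ & _ & Pi) (_ & _ & Pj).
  (* Disjointness is visible at a single point: Re (z conj z0) cannot have both signs at 0. *)
  assert (P0 : 0 <= 0 <= 2 * PI) by (assert (h := PI_RGT_0); lra).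
  specialize (Pi 0 P0); specialize (Pj 0 P0).
  destruct i as [|[|i]], j as [|[|j]]; try lia; simpl in Pi, Pj; lra.
- intros i Hi; split; [|split; [|split; [|split]]].
  + exists (fun q => pos_on_period (dot c (Phi q)) /\
      pos_on_period (fun x => sheet_sign i * pair_dot p q x)); split.
    * exact (open_sheet p c (sheet_sign i)).
    * intros q; split.
      (* The condition that [Phi q] be a based unit curve of the right parity is not open in the
         space of pairs, so it is absent from the open set and recovered from membership of q in
         [St0 s]. *)
      -- intros (Sq & Uq & Pq); split; [exact Sq|]; split; [apply Uq | exact Pq].
      -- intros (Sq & Uq & Pq); split; [exact Sq|]; split; [|exact Pq].
         split; [now apply Phi_based_unit_curves | exact Uq].
  + intros q (Sq & Uq & Pq); apply local_section_unique; auto using Phi_velocity_root.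
  + intros y Uy; assert (Py := PU y Uy); destruct Uy as [By Dy].
    assert (R := local_section_root p c Rp NZ y Py i).
    assert (E : Phi (local_section p c i y) = y) by (apply velocity_root_Phi; [exact R | apply By]).
    split; [|exact E]; rewrite E; split; [|split; [now split|]].
    * destruct (local_section_V p c NZ y Py s i Ve Vf Pc (proj1 (proj1 By))) as [V1 V2].
      now apply velocity_root_St0 with y.
    * intros x _; now apply local_section_sign.
  + exact (local_section_continuous_on p c U i NZ PU).
  + apply local_section_smooth_on; [exact NZ | exact PU].
Qed.

Theorem mainTheorem1 : forall s : parity,
  (forall p : smooth_pair, St0 s p -> based_unit_curves s (Phi p)) /\
  smooth_covering 2 (St0 s) (based_unit_curves s) Phi /\
  (forall p : smooth_pair, St0 s p ->
    (forall v : smooth_pair, tangent_St s p v ->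
      exists h : smooth_pair, is_directional_derivative Phi p v h /\
        tangent_based_unit_curves (Phi p) h /\
        metric_G (Phi p) h = 2 * metric_St v) /\
    (forall h : smooth_pair, tangent_based_unit_curves (Phi p) h ->
      exists! v : smooth_pair, tangent_St s p v /\ is_directional_derivative Phi p v h)).
Proof.
intros s; split; [apply Phi_based_unit_curves|].
split; [apply Phi_smooth_covering|]; intros p Hp; split.
- intros v Tv; exists (dPhi p v); split; [apply Phi_directional_derivative|].
  split; [now apply dPhi_tangent with s|].
  exact (velocity_prod_metric s p v _ Hp (dPhi_velocity_prod p v)).
- intros h Th; destruct (tangent_lift s p h Hp Th) as (v & Tv & H).
  exists v; split.
  + split; [exact Tv|].
    rewrite (velocity_prod_dPhi p v h H); [apply Phi_directional_derivative | apply Th].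
  (* Directional derivatives are unique, so h' = z w as well as h' = z v, and dividing by the
     nowhere vanishing z identifies v with w. *)
  + intros w [_ Dw]; apply Phi_directional_derivative_unique in Dw; subst h.
    assert (P := fun x => sum_sqr_pos _ _ (proj2 Hp x)).
    assert (H' := dPhi_velocity_prod p w).
    rewrite (surjective_pairing v), (surjective_pairing w).
    apply (f_equal2 pair); apply smooth_fun_eq; intros x;
      destruct (velocity_prod_inv _ _ _ x H (P x)) as [A B];
      destruct (velocity_prod_inv _ _ _ x H' (P x)) as [A' B'];
      [now rewrite A, A' | now rewrite B, B'].
Qed.
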